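(* Let $\rho$ be any relation, defined on the states of the labelled transition system associated with every succinct one-counter net, such that on each such system bisimulation equivalence is contained in $\rho$ and $\rho$ is contained in simulation preorder. Then the problem of deciding, given a succinct one-counter net $\mathcal{N}$ (integers in binary) and two configurations $p(m),q(n)$ of $\mathcal{N}$, whether $(p(m),q(n))\in\rho$, is EXPSPACE-hard.
   Context: A labelled transition system (LTS) is $(S,Act,(\xrightarrow{a})_{a\in Act})$ with $\xrightarrow{a}\subseteq S\times S$. A relation $R\subseteq S\times S$ is a simulation if for every $(s,s')\in R$ and every $s\xrightarrow{a}t$ there is $s'\xrightarrow{a}t'$ with $(t,t')\in R$; it is a bisimulation if moreover for every $(s,s')\in R$ and every $s'\xrightarrow{a}t'$ there is $s\xrightarrow{a}t$ with $(t,t')\in R$. Simulation preorder is the union of all simulations; bisimulation equivalence is the union of all bisimulations. A succinct one-counter net (SOCN) is $\mathcal{N}=(Q,Act,\delta)$ with finite sets $Q$ (control states) and $Act$ (actions) and a finite set of rules $\delta\subseteq Q\times Act\times\mathbb{Z}\times Q$, integers written in binary. Its associated LTS has states (configurations) $q(m)=(q,m)\in Q\times\mathbb{N}$ and $q(m)\xrightarrow{a}q'(n)$ iff $(q,a,n-m,q')\in\delta$. *)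

(* Defs.v *)
From Corelib Require Import BinNums.
From HB Require Import structures.
From mathcomp Require Import all_boot all_order all_algebra finmap.

Set Implicit Arguments.
Unset Strict Implicit.
Unset Printing Implicit Defensive.

Local Open Scope nat_scope.

Record lts := Lts {
  lts_state : Type;
  lts_act : Type;
  lts_trans : lts_act -> lts_state -> lts_state -> Prop }.

Definition simulation (T : lts) (R : lts_state T -> lts_state T -> Prop) : Prop :=
  forall s s', R s s' ->
  forall a t, lts_trans a s t -> exists t', lts_trans a s' t' /\ R t t'.

Definition bisimulation (T : lts) (R : lts_state T -> lts_state T -> Prop) : Prop :=
  simulation R /\
  forall s s', R s s' ->
  forall a t', lts_trans a s' t' -> exists t, lts_trans a s t /\ R t t'.

Definition sim_preorder (T : lts) (s s' : lts_state T) : Prop :=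
  exists R, simulation R /\ R s s'.

Definition bisim_equiv (T : lts) (s s' : lts_state T) : Prop :=
  exists R, bisimulation R /\ R s s'.

Record socn := Socn {
  socn_ctrl : finType;
  socn_act : finType;
  socn_rules : {fset socn_ctrl * socn_act * int * socn_ctrl} }.

Definition socn_lts (N : socn) : lts :=
  @Lts (socn_ctrl N * nat)%type (socn_act N)
    (fun a c d => (c.1, a, (d.2%:Z - c.2%:Z)%R, d.1) \in socn_rules N).

(* Turing machine tapes are infinite to the right only, and a left move on cell
   0 leaves the head where it is.  The blank symbol is [None]. *)

Inductive move := MoveLeft | Stay | MoveRight.

Definition move_head (m : move) (h : nat) : nat :=
  match m with MoveLeft => h.-1 | Stay => h | MoveRight => h.+1 end.

(* A machine with [k.+1] tapes; it halts when [tm_delta] returns [None]. *)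
Record tm (k : nat) := Tm {
  tm_state : finType;
  tm_sym : finType;
  tm_start : tm_state;
  tm_delta : tm_state -> {ffun 'I_k.+1 -> option tm_sym} ->
    option (tm_state * {ffun 'I_k.+1 -> option tm_sym * move}) }.

Record tm_conf (k : nat) (M : tm k) := TmConf {
  conf_state : tm_state M;
  conf_tape : 'I_k.+1 -> nat -> option (tm_sym M);
  conf_head : 'I_k.+1 -> nat }.

Definition tm_next (k : nat) (M : tm k) (c : tm_conf M) :=
  tm_delta (conf_state c) [ffun i => conf_tape c i (conf_head c i)].

Definition tm_step (k : nat) (M : tm k) (c : tm_conf M) : tm_conf M :=
  if tm_next c is Some (q, act) then
    TmConf q
      (fun i j => if j == conf_head c i then (act i).1 else conf_tape c i j)
      (fun i => move_head (act i).2 (conf_head c i))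
  else c.

Definition tm_halted (k : nat) (M : tm k) (c : tm_conf M) : Prop :=
  tm_next c = None.

Definition tm_init (k : nat) (M : tm k) (u : seq (tm_sym M)) : tm_conf M :=
  TmConf (tm_start M) (fun i => if i == ord0 then onth u else fun=> None)
    (fun=> 0).

Definition tm_run (k : nat) (M : tm k) (u : seq (tm_sym M)) (t : nat) : tm_conf M :=
  iter t (@tm_step k M) (tm_init u).

(* The alphabet [S] of the language is embedded in the tape alphabet by [inp]. *)
Definition decides (S : finType) (k : nat) (M : tm k) (inp : S -> tm_sym M)
    (acc : pred (tm_state M)) (A : seq S -> Prop) : Prop :=
  forall w : seq S, exists t,
    tm_halted (tm_run (map inp w) t) /\
    (acc (conf_state (tm_run (map inp w) t)) <-> A w).

(* The union over the polynomials [p] of DSPACE(2^p), on single-tape machines;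
   heads move by at most one cell, so bounding their position bounds the number
   of visited cells. *)
Definition EXPSPACE (S : finType) (A : seq S -> Prop) : Prop :=
  exists (M : tm 0) (inp : S -> tm_sym M) (acc : pred (tm_state M)) (p : {poly nat}),
    [/\ injective inp,
        decides inp acc A
      & forall (w : seq S) (t : nat),
          conf_head (tm_run (map inp w) t) ord0 < 2 ^ p.[size w]%R].

(* The input is on the first tape and the output on the last one. *)
Definition polytime (S D : finType) (f : seq S -> seq D) : Prop :=
  exists (k : nat) (M : tm k) (inp : S -> tm_sym M) (out : D -> tm_sym M)
      (p : {poly nat}),
    [/\ injective inp,
        injective out
      & forall w : seq S, exists t : nat,
          [/\ t <= p.[size w]%R,
              tm_halted (tm_run (map inp w) t)
            & conf_tape (tm_run (map inp w) t) ord_max =1 onth (map out (f w))]].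

Definition polytime_reducible (S D : finType)
    (A : seq S -> Prop) (B : seq D -> Prop) : Prop :=
  exists f : seq S -> seq D, polytime f /\ forall w, A w <-> B (f w).

Definition EXPSPACE_hard (D : finType) (B : seq D -> Prop) : Prop :=
  forall (S : finType) (A : seq S -> Prop), EXPSPACE A -> polytime_reducible A B.

(* Concrete presentation of a net, with numbered control states and actions and
   its rules listed in some order, together with two of its configurations. *)
Record instance := Instance {
  inst_nctrl : nat;
  inst_nact : nat;
  inst_rules : seq ('I_inst_nctrl * 'I_inst_nact * int * 'I_inst_nctrl);
  inst_left : 'I_inst_nctrl * nat;
  inst_right : 'I_inst_nctrl * nat }.

Definition inst_socn (I : instance) : socn :=
  @Socn 'I_(inst_nctrl I) 'I_(inst_nact I) [fset r in inst_rules I]%fset.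

(* Words are over [option bool]: bits, and the end marker [None].  Counter values
   and rule weights are in binary, least significant bit first (weights preceded
   by a sign bit).  The sets of control states and of actions count for their
   cardinality in the size of a net, hence are described in unary. *)

Definition field (s : seq bool) : seq (option bool) := rcons (map Some s) None.

Definition unary (n : nat) : seq bool := nseq n true.

Fixpoint pos_bits (p : positive) : seq bool :=
  match p with
  | xH => [:: true]
  | xO p' => false :: pos_bits p'
  | xI p' => true :: pos_bits p'
  end.

Definition nat_bits (n : nat) : seq bool :=
  if bin_of_nat n is Npos p then pos_bits p else [::].

Definition int_bits (z : int) : seq bool := (z < 0)%R :: nat_bits `|z|%N.

Definition encode_conf (n : nat) (c : 'I_n * nat) : seq (option bool) :=
  field (unary c.1) ++ field (nat_bits c.2).

Definition encode_rule (n m : nat) (r : 'I_n * 'I_m * int * 'I_n) :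
    seq (option bool) :=
  let: (q, a, z, q') := r in
  field (unary q) ++ field (unary a) ++ field (int_bits z) ++ field (unary q').

Definition encode (I : instance) : seq (option bool) :=
  field (unary (inst_nctrl I)) ++ field (unary (inst_nact I)) ++
  encode_conf (inst_left I) ++ encode_conf (inst_right I) ++
  flatten (map (@encode_rule _ _) (inst_rules I)).

Definition relation_problem
    (rho : forall N : socn, lts_state (socn_lts N) -> lts_state (socn_lts N) -> Prop) :
    seq (option bool) -> Prop :=
  fun u => exists I : instance,
    u = encode I /\ rho (inst_socn I) (inst_left I) (inst_right I).

Lemma field_cat_inj (s s' : seq bool) (u u' : seq (option bool)) :
  field s ++ u = field s' ++ u' -> s = s' /\ u = u'.
Proof.
rewrite /field !cat_rcons.
elim: s s' => [|x s IH] [|y s'] //=; first by case=> ->.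
by case=> -> /IH [-> ->].
Qed.

Lemma pos_bits_inj : injective pos_bits.
Proof.
have nil p : pos_bits p <> [::] by case: p.
elim=> [p IH|p IH|] [q|q|] //= [].
- by move/IH->.
- by move/nil.
- by move/IH->.
- by move/esym/nil.
Qed.

Lemma nat_bits_inj : injective nat_bits.
Proof.
move=> m n; rewrite /nat_bits -{2}(bin_of_natK m) -{2}(bin_of_natK n).
case: (bin_of_nat m) (bin_of_nat n) => [|p] [|q] //=.
- by case: q.
- by case: p.
- by move/pos_bits_inj->.
Qed.

Lemma int_bits_inj : injective int_bits.
Proof. by move=> [m|m] [n|n] [] // /nat_bits_inj => [->|[->]]. Qed.

Lemma unary_inj : injective unary.
Proof. by move=> m n /(congr1 size); rewrite !size_nseq. Qed.

Lemma encode_inj : injective encode.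
Proof.
case=> [n m r [p i] [q j]] [n' m' r' [p' i'] [q' j']].
rewrite /encode /encode_conf /= -!catA.
case/field_cat_inj=> /unary_inj En; case/field_cat_inj=> /unary_inj Em.
case: _ / En p' q' r' => p' q' r'; case: _ / Em r' => r'.
case/field_cat_inj=> /unary_inj/val_inj-> /field_cat_inj[/nat_bits_inj->].
case/field_cat_inj=> /unary_inj/val_inj-> /field_cat_inj[/nat_bits_inj->] Er.
suff -> : r = r' by [].
have consE k l (x : 'I_k * 'I_l * int * 'I_k) t :
  flatten (map (@encode_rule k l) (x :: t)) =
    field (unary x.1.1.1) ++ field (unary x.1.1.2) ++ field (int_bits x.1.2) ++
    field (unary x.2) ++ flatten (map (@encode_rule k l) t).
  case: x => [[[a b] z] c]; rewrite map_cons.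
  by rewrite -[LHS]/(encode_rule _ ++ flatten _) /encode_rule -!catA.
elim: r r' Er => [|x r IH] [|x' r']; rewrite ?consE //.
- by rewrite /field; case: (unary _).
- by rewrite /field; case: (unary _).
case: x x' => [[[a b] z] c] [[[a' b'] z'] c'].
case/field_cat_inj=> /unary_inj/val_inj Ea.
case/field_cat_inj=> /unary_inj/val_inj Eb.
case/field_cat_inj=> /int_bits_inj Ez /field_cat_inj[/unary_inj/val_inj Ec].
by move=> /IH->; move: Ea Eb Ez Ec => /= -> -> -> ->.
Qed.

(* Main.v *)
(* Alternation gives EXPSPACE: the computation table of an exponential-space
   machine [M], read row by row, is a word whose letter at index i depends only
   on the letters at i - L - 1, i - L, i - L + 1, where L = 2^(R+1) is the row
   length.  An attacker who holds i in the counter and claims a letter names the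
   three letters above it, and the defender picks one of them, subtracting
   L + 1, L or L - 1; in row 0 the claim is checked against the input.  The
   attacker first guesses an index by increments and claims that it holds a
   rejecting halting cell.  Each position of this game becomes a pair of
   control states that are bisimilar when the claim is false, and of which the
   first is not simulated by the second when it is true; so every relation
   between bisimilarity and simulation preorder decides acceptance by [M].
   Attacker moves are copied in both components, a defender's choice is made by
   nondeterminism of the second component when the attacker announces the
   triple, and "the counter is 0" is tested by a rule with weight 0 in the first
   component and -1 in the second.  The reduction is written as a program for a
   machine with unary counters, which only counts the input, evaluates a
   polynomial and prints rules in loops. *)

Require Import Defs.
From Corelib Require Import BinNums.
From HB Require Import structures.
From mathcomp Require Import all_boot all_order all_algebra finmap zify.
From Stdlib Require Import FunctionalExtensionality.

Set Implicit Arguments.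
Unset Strict Implicit.
Unset Printing Implicit Defensive.

Local Open Scope nat_scope.

(** * Counter programs on Turing machines *)

Lemma onth_rcons T (s : seq T) x j :
  onth (rcons s x) j = if j == size s then Some x else onth s j.
Proof. by elim: s j => [|y s IH] [|j] //=; rewrite ?IH ?eqSS //; case: j. Qed.

Section Fragments.

Variables (S D : finType) (k : nat).

Notation sym := (S + option D)%type.
Notation tape := 'I_k.+2.
Notation reads := {ffun tape -> option sym}.
Notation acts := {ffun tape -> option sym * move}.

Definition mark : sym := inr None.

Record frag := Frag {
  frag_state : finType;
  frag_start : frag_state;
  frag_delta : frag_state -> reads -> option (frag_state * acts) }.

Definition machine (F : frag) : tm k.+1 := @Tm k.+1 _ sym (frag_start F) (@frag_delta F).

Definition conf_map (F G : frag) (g : frag_state F -> frag_state G)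
    (c : tm_conf (machine F)) : tm_conf (machine G) :=
  @TmConf _ (machine G) (g (conf_state c)) (conf_tape c) (conf_head c).

(** Every counted step starts in a configuration that has not halted. This makes runs transportable
    into a larger machine, where a halting state of the part may acquire transitions. *)
Inductive run (F : frag) : tm_conf (machine F) -> nat -> tm_conf (machine F) -> Prop :=
| run0 c : run c 0 c
| runS c t c' : tm_next c <> None -> run (tm_step c) t c' -> run c t.+1 c'.

Lemma run_cat F (c1 c2 c3 : tm_conf (machine F)) t u :
  run c1 t c2 -> run c2 u c3 -> run c1 (t + u) c3.
Proof. by elim=> // c t' c' nh _ IH /IH; apply: runS. Qed.

Lemma run_iter F (c c' : tm_conf (machine F)) t :
  run c t c' -> iter t (@tm_step _ _) c = c'.
Proof. by elim=> // {}c {}t {}c' _ _ <-; rewrite iterSr. Qed.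

Lemma run_map F G (g : frag_state F -> frag_state G) c t c' :
  (forall q v r, frag_delta q v = Some r ->
     frag_delta (g q) v = Some (g r.1, r.2)) ->
  run c t c' -> run (conf_map g c) t (conf_map g c').
Proof.
move=> gP; elim=> [{}c|{}c {}t {}c' nh _ IH]; first exact: run0.
case E: (tm_next c) nh => [[q a]|] // _.
have E' : tm_next (conf_map g c) = Some (g q, a) by move: E; rewrite /tm_next /= => /gP.
apply: runS; first by rewrite E'.
by move: IH; rewrite /tm_step E E'.
Qed.

Variable w : seq S.

Definition tapes (out : seq D) (i : tape) : nat -> option sym :=
  if i == ord0 then onth (map inl w) else
  if i == ord_max then onth (map (inr \o Some) out) else
  fun j => if j == 0 then Some mark else None.

(* The value of a counter is the position of the head on its tape; the only
   nonblank cell of that tape is cell 0, which makes the value 0 detectable. *)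
Definition cf (F : frag) (q : frag_state F) (h : seq nat) (out : seq D) :
    tm_conf (machine F) :=
  @TmConf _ (machine F) q (tapes out)
    (fun i => if i == ord_max then size out else nth 0 h i).

(** The final state is left existential because a conditional may halt in several states. *)
Definition reaches (F : frag) (s s' : seq nat * seq D) (b : nat) : Prop :=
  exists t q, [/\ t <= b, run (cf (frag_start F) s.1 s.2) t (cf q s'.1 s'.2)
    & tm_halted (cf q s'.1 s'.2)].

Lemma reachesW F s s' b b' : b <= b' -> reaches F s s' b -> reaches F s s' b'.
Proof. by move=> le [t [q [tb r h]]]; exists t, q; split=> //; apply: leq_trans le. Qed.

Definition noop (v : reads) : acts := [ffun i => (v i, Stay)].

Definition rd (h : seq nat) (out : seq D) : reads :=
  [ffun i => tapes out i (if i == ord_max then size out else nth 0 h i)].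

Lemma next_cf F (q : frag_state F) h out : tm_next (cf q h out) = frag_delta q (rd h out).
Proof. by []. Qed.

Lemma step_noop F (q q' : frag_state F) h out :
  frag_delta q (rd h out) = Some (q', noop (rd h out)) ->
  run (cf q h out) 1 (cf q' h out).
Proof.
move=> E; apply: runS; first by rewrite next_cf E.
rewrite /tm_step next_cf E.
suff -> : TmConf (M := machine F) q' (fun i j =>
    if j == conf_head (cf q h out) i then (noop (rd h out) i).1
    else conf_tape (cf q h out) i j)
  (fun i => move_head (noop (rd h out) i).2 (conf_head (cf q h out) i)) = cf q' h out.
  exact: run0.
congr TmConf; apply: functional_extensionality => i; rewrite !ffunE //.
apply: functional_extensionality => j /=.
by case: eqP => [->|].
Qed.

(** * Sequencing, conditionals and loops, with time bounds *)

Definition fskip : frag := @Frag unit tt (fun _ _ => None).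

Lemma reaches_skip s : reaches fskip s s 0.
Proof. by exists 0, tt; split=> //; apply: run0. Qed.

Definition fseq (F G : frag) : frag :=
  @Frag (frag_state F + frag_state G)%type (inl (frag_start F)) (fun q v =>
    match q with
    | inl q => if frag_delta q v is Some r then Some (inl r.1, r.2)
               else Some (inr (frag_start G), noop v)
    | inr q => if frag_delta q v is Some r then Some (inr r.1, r.2) else None
    end).

(** The halt of [F] becomes one idle step to the start of [G], whence the successor in the bound. *)
Lemma reaches_seq F G s1 s2 s3 b c :
  reaches F s1 s2 b -> reaches G s2 s3 c -> reaches (fseq F G) s1 s3 (b + c).+1.
Proof.
move=> [t [q [tb r hq]]] [u [p [uc r' hp]]].
exists (t + (1 + u)), (inr p : frag_state (fseq F G)); split.
- by rewrite addnA addn1 addSn ltnS leq_add.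
- apply: run_cat (_ : run _ _ (cf (inl q : frag_state (fseq F G)) s2.1 s2.2)) _.
    by apply: (@run_map F (fseq F G) inl) r => /= q0 v r0 ->.
  apply: run_cat (_ : run _ _ (cf (inr (frag_start G) : frag_state (fseq F G)) s2.1 s2.2)) _.
    by apply: step_noop; move: hq; rewrite /tm_halted next_cf /= => ->.
  by apply: (@run_map G (fseq F G) inr) r' => /= q0 v r0 ->.
- by move: hp; rewrite /tm_halted !next_cf /= => ->.
Qed.

Definition fif (test : pred reads) (F : frag) : frag :=
  @Frag (option (frag_state F)) None (fun q v =>
    match q with
    | None => if test v then Some (Some (frag_start F), noop v) else None
    | Some q => if frag_delta q v is Some r then Some (Some r.1, r.2) else None
    end).

Lemma reaches_ifT (test : pred reads) F s s' b :
  test (rd s.1 s.2) -> reaches F s s' b -> reaches (fif test F) s s' b.+1.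
Proof.
move=> ts [t [q [tb r hq]]]; exists (1 + t), (Some q : frag_state (fif test F)); split=> //.
- apply: run_cat (_ : run _ _ (cf (Some (frag_start F) : frag_state (fif test F)) s.1 s.2)) _.
    by apply: step_noop; rewrite /= ts.
  by apply: (@run_map F (fif test F) Some) r => /= q0 v r0 ->.
- by move: hq; rewrite /tm_halted !next_cf /= => ->.
Qed.

Lemma reaches_ifF (test : pred reads) F s : ~~ test (rd s.1 s.2) -> reaches (fif test F) s s 0.
Proof.
move=> /negbTE ts; exists 0, None; split=> //; first exact: run0.
by rewrite /tm_halted next_cf /= ts.
Qed.

Definition fwhile (test : pred reads) (F : frag) : frag :=
  @Frag (option (frag_state F)) None (fun q v =>
    match q with
    | None => if test v then Some (Some (frag_start F), noop v) else None
    | Some q => if frag_delta q v is Some r then Some (Some r.1, r.2)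
                else Some (None, noop v)
    end).

Lemma reaches_while0 (test : pred reads) F s :
  ~~ test (rd s.1 s.2) -> reaches (fwhile test F) s s 0.
Proof.
move=> /negbTE ts; exists 0, None; split=> //; first exact: run0.
by rewrite /tm_halted next_cf /= ts.
Qed.

(** Two idle steps are charged per round: entering the body and returning to the test. *)
Lemma reaches_whileS (test : pred reads) F s1 s2 s3 b c :
  test (rd s1.1 s1.2) -> reaches F s1 s2 b -> reaches (fwhile test F) s2 s3 c ->
  reaches (fwhile test F) s1 s3 (b + c).+2.
Proof.
move=> ts [t [q [tb r hq]]] [u [p [uc r' hp]]].
exists (1 + (t + (1 + u))), p; split=> //.
- by rewrite add1n addnCA add1n !ltnS leq_add.
- apply: run_cat (_ : run _ _ (cf (Some (frag_start F) : frag_state (fwhile test F)) s1.1 s1.2)) _.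
    by apply: step_noop; rewrite /= ts.
  apply: run_cat (_ : run _ _ (cf (Some q : frag_state (fwhile test F)) s2.1 s2.2)) _.
    by apply: (@run_map F (fwhile test F) Some) r => /= q0 v r0 ->.
  apply: run_cat r'; apply: step_noop.
  by move: hq; rewrite /tm_halted next_cf /= => ->.
Qed.

Lemma reaches_while (test : pred reads) F (s : nat -> seq nat * seq D) m b :
  (forall i, i < m -> test (rd (s i).1 (s i).2)) ->
  ~~ test (rd (s m).1 (s m).2) ->
  (forall i, i < m -> reaches F (s i) (s i.+1) b) ->
  reaches (fwhile test F) (s 0) (s m) (m * b.+2).
Proof.
elim: m s => [|m IH] s tT tF sP; first by rewrite mul0n; apply: reaches_while0.
rewrite mulSn !addSn; apply: reaches_whileS (sP 0 _) _ => //; first exact: tT.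
by apply: (IH (s \o succn)) => //= i im; [apply: tT|apply: sP].
Qed.

(** * Elementary actions and tests *)

Definition fact (a : reads -> acts) : frag :=
  @Frag bool false (fun q v => if q then None else Some (true, a v)).

Definition femit (d : D) : frag :=
  fact (fun v => [ffun i => if i == ord_max then (Some (inr (Some d)), MoveRight)
                            else (v i, Stay)]).

Lemma reaches_emit d h out : reaches (femit d) (h, out) (h, rcons out d) 1.
Proof.
exists 1, true; split=> //; apply: runS => //.
rewrite /tm_step next_cf /=.
set c := TmConf _ _ _.
suff -> : c = cf (true : frag_state (femit d)) h (rcons out d) by exact: run0.
congr TmConf; apply: functional_extensionality => i; rewrite !ffunE /=; last first.
  by case: ifP => _ //=; rewrite size_rcons.
apply: functional_extensionality => j; rewrite /tapes.
have [->|i0] := eqVneq i ord_max; rewrite /=; last by case: eqP => [->|].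
by rewrite map_rcons onth_rcons size_map.
Qed.

Definition fmove (r : tape) (m : move) : frag :=
  fact (fun v => [ffun i => (v i, if i == r then m else Stay)]).

(** On a counter, [move_head] is increment or truncated decrement. The output tape is excluded
    because [cf] ties its head to the length of the output. *)
Lemma reaches_move r m h out : r != ord_max ->
  reaches (fmove r m) (h, out) (set_nth 0 h r (move_head m (nth 0 h r)), out) 1.
Proof.
move=> rm; exists 1, true; split=> //; apply: runS => //.
rewrite /tm_step next_cf /=.
set c := TmConf _ _ _; set h' := set_nth _ _ _ _.
suff -> : c = cf (true : frag_state (fmove r m)) h' out by exact: run0.
congr TmConf; apply: functional_extensionality => i; rewrite !ffunE /=; last first.
  rewrite nth_set_nth /= (inj_eq val_inj).
  by have [->|] := eqVneq i r; rewrite ?(negbTE rm).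
by apply: functional_extensionality => j; case: eqP => [->|].
Qed.

Definition is_counter (r : tape) := (r != ord0) && (r != ord_max).

Definition nonzero (r : tape) : pred reads := fun v => v r != Some mark.

Lemma nonzeroE r h out : is_counter r -> nonzero r (rd h out) = (nth 0 h r != 0).
Proof.
case/andP=> r0 rm; rewrite /nonzero ffunE /tapes (negbTE r0) (negbTE rm).
by case: ifP => // _; rewrite eqxx.
Qed.

Definition input_is (o : option S) : pred reads := fun v => v ord0 == omap inl o.

Lemma input_isE o h out : input_is o (rd h out) = (onth w (nth 0 h 0) == o).
Proof.
rewrite /input_is ffunE /tapes eqxx /= onth_map.
by case: (onth w _) o => [x|] [y|].
Qed.

Definition fseqs (Fs : seq frag) : frag := foldr fseq fskip Fs.

Definition femits (s : seq D) : frag := fseqs (map femit s).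

Lemma reaches_emits s h out : reaches (femits s) (h, out) (h, out ++ s) (size s).*2.
Proof.
elim: s out => [|d s IH] out /=; first by rewrite cats0; apply: reaches_skip.
rewrite -cat_rcons doubleS.
exact: (@reaches_seq _ _ _ (h, rcons out d) _ 1 _.*2 (reaches_emit _ _ _) (IH _)).
Qed.

(* [x] is the iteration index seen by [F]; the second loop restores [r]. *)
Definition floop (r x : tape) (F : frag) : frag :=
  fseq (fwhile (nonzero r) (fseq (fmove r MoveLeft) (fseq F (fmove x MoveRight))))
       (fwhile (nonzero x) (fseq (fmove x MoveLeft) (fmove r MoveRight))).

Definition set2 (r x : tape) (h : seq nat) (a c : nat) : seq nat :=
  set_nth 0 (set_nth 0 h r a) x c.

(** [H i] describes the other counters after [i] rounds; its entries at [r] and [x] are overwritten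
    by [set2]. A round costs [b + 6] in the first loop and 5 in the second, so the constant 12
    leaves slack. *)
Lemma reaches_loop r x F (H : nat -> seq nat) (o : nat -> seq D) m b :
  is_counter r -> is_counter x -> r != x ->
  (forall i, i < m -> reaches F (set2 r x (H i) (m - i.+1) i, o i)
                                (set2 r x (H i.+1) (m - i.+1) i, o i.+1) b) ->
  reaches (floop r x F) (set2 r x (H 0) m 0, o 0) (set2 r x (H m) m 0, o m) 
    (m * (b + 12)).+1.
Proof.
move=> rc xc rx FP.
have rx' : (r == x :> nat) = false by apply: contraNF rx => /eqP/val_inj ->.
have E2 h a c : nth 0 (set2 r x h a c) r = a /\ nth 0 (set2 r x h a c) x = c.
  by rewrite /set2 !nth_set_nth /= nth_set_nth /= !eqxx rx' /=.
have [[_ rm] [_ xm]] := (andP rc, andP xc).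
have setr h a c v : set_nth 0 (set2 r x h a c) r v = set2 r x h v c.
  by rewrite /set2 set_set_nth eq_sym rx' (set_set_nth _ _ r a r v) eqxx.
have setx h a c v : set_nth 0 (set2 r x h a c) x v = set2 r x h a v.
  by rewrite /set2 set_set_nth eqxx.
have := @reaches_while (nonzero r) (fseq (fmove r MoveLeft) (fseq F (fmove x MoveRight)))
  (fun i => (set2 r x (H i) (m - i) i, o i)) m (b + 4).
rewrite subn0 subnn => W1.
have := @reaches_while (nonzero x) (fseq (fmove x MoveLeft) (fmove r MoveRight))
  (fun i => (set2 r x (H m) i (m - i), o m)) m 3.
rewrite subn0 subnn => W2.
suff -> : (m * (b + 12)).+1 = (m * (b + 4).+2 + m * 5 + m).+1.
  apply: reachesW (reaches_seq (W1 _ _ _) (W2 _ _ _)).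
  - by rewrite ltnS leq_addr.
  - by move=> i im; rewrite nonzeroE //= (E2 _ _ _).1 -lt0n subn_gt0.
  - by rewrite nonzeroE //= (E2 _ _ _).1.
  - move=> i im; rewrite (_ : b + 4 = (1 + b.+2).+1) ?addn4 ?add1n //.
    apply: (@reaches_seq _ _ _ (set2 r x (H i) (m - i.+1) i, o i) _ 1 b.+2).
      have := reaches_move MoveLeft (set2 r x (H i) (m - i) i) (o i) rm.
      by rewrite (E2 _ _ _).1 setr /= -subnS.
    have -> : b.+2 = (b + 1).+1 by rewrite addn1.
    apply: (@reaches_seq _ _ _ _ _ b 1) (FP i im) _.
    have := reaches_move MoveRight (set2 r x (H i.+1) (m - i.+1) i) (o i.+1) xm.
    by rewrite (E2 _ _ _).2 setx.
  - by move=> i im; rewrite nonzeroE //= (E2 _ _ _).2 -lt0n subn_gt0.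
  - by rewrite nonzeroE //= (E2 _ _ _).2.
  - move=> i im; apply: (@reaches_seq _ _ _ (set2 r x (H m) i (m - i.+1), o m) _ 1 1).
      have := reaches_move MoveLeft (set2 r x (H m) i (m - i)) (o m) xm.
      by rewrite (E2 _ _ _).2 setx /= -subnS.
    have := reaches_move MoveRight (set2 r x (H m) i (m - i.+1)) (o m) rm.
    by rewrite (E2 _ _ _).1 setr.
by lia.
Qed.

Lemma set2_id (r x : tape) h : r < size h -> x < size h ->
  nth 0 h x = 0 -> set2 r x h (nth 0 h r) 0 = h.
Proof.
move=> rh xh hx; rewrite /set2.
have -> : set_nth 0 h r (nth 0 h r) = h.
  apply: (@eq_from_nth _ 0) => [|i _]; first by rewrite size_set_nth; apply/maxn_idPr.
  by rewrite nth_set_nth /=; case: eqP => [->|].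
apply: (@eq_from_nth _ 0) => [|i _]; first by rewrite size_set_nth; apply/maxn_idPr.
by rewrite nth_set_nth /=; case: eqP => [->|].
Qed.

(** * Printing words whose repetition numbers are counter values *)

Definition em : Type := option tape * seq D.

Definition emval (h : seq nat) (e : em) : seq D :=
  flatten (nseq (if e.1 is Some r then nth 0 h r else 1) e.2).

Definition emsval (h : seq nat) (es : seq em) : seq D := flatten (map (emval h) es).

Definition fem (y : tape) (e : em) : frag :=
  if e.1 is Some r then floop r y (femits e.2) else femits e.2.

Definition fems (y : tape) (es : seq em) : frag := fseqs (map (fem y) es).

Definition em_wf (y : tape) (e : em) : bool :=
  if e.1 is Some r then is_counter r && (r != y) else true.

Definition ems_cost (es : seq em) : nat := sumn [seq (size e.2).*2 + 14 | e <- es].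

Lemma counter_lt (r : tape) : is_counter r -> r < k.+1.
Proof.
by case/andP=> _; have := ltn_ord r; rewrite ltnS leq_eqVlt -val_eqE /= => /orP[->|].
Qed.

(** The scratch counter [y] starts and ends at 0 and [floop] restores [r], so printing leaves all
    counters as they were. *)
Lemma reaches_em y e h out B : is_counter y -> em_wf y e -> size h = k.+1 ->
  nth 0 h y = 0 -> (forall i, nth 0 h i <= B) ->
  reaches (fem y e) (h, out) (h, out ++ emval h e) (((size e.2).*2 + 13) * B.+1).
Proof.
case: e => [[r|] s] yc /= => [/andP[rc ry]|_] sh y0 hB; last first.
  rewrite /fem /emval /= cats0; apply: reachesW (reaches_emits _ _ _).
  by rewrite mulnS -addnA leq_addr.
rewrite /fem /emval /=; set m := nth 0 h r.
have rh : r < size h by rewrite sh counter_lt.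
have yh : y < size h by rewrite sh counter_lt.
have := @reaches_loop r y (femits s) (fun=> h) (fun i => out ++ flatten (nseq i s)) m
  (size s).*2 rc yc ry.
rewrite set2_id // cats0 => H; apply: reachesW (H _).
  by have := hB r; rewrite -/m => mB; rewrite mulnDl; nia.
move=> i _; have := reaches_emits s (set2 r y h (m - i.+1) i) (out ++ flatten (nseq i s)).
rewrite -catA; suff -> : flatten (nseq i s) ++ s = flatten (nseq i.+1 s) by [].
by elim: i => [|i IH] /=; rewrite ?cats0 // -catA IH.
Qed.

Lemma reaches_ems y es h out B : is_counter y -> all (em_wf y) es -> size h = k.+1 ->
  nth 0 h y = 0 -> (forall i, nth 0 h i <= B) ->
  reaches (fems y es) (h, out) (h, out ++ emsval h es) (ems_cost es * B.+1).
Proof.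
move=> yc + sh y0 hB; elim: es out => [|e es IH] out /=.
  by rewrite cats0 => _; apply: reaches_skip.
case/andP=> ewf eswf; rewrite catA.
apply: reachesW (reaches_seq (reaches_em out yc ewf sh y0 hB) (IH _ eswf)).
by rewrite /ems_cost /=; nia.
Qed.

Definition fselect (Fs : option S -> frag) : frag :=
  fseqs [seq fif (input_is o) (Fs o) | o <- enum {: option S}].

(** The cascade tests all letters and the blank. The chosen branch leaves the input head in place,
    so the later tests fail. *)
Lemma reaches_select Fs h out out' b :
  reaches (Fs (onth w (nth 0 h 0))) (h, out) (h, out') b ->
  reaches (fselect Fs) (h, out) (h, out') (b + (#|{: option S}|.+1).*2).
Proof.
set o := onth _ _ => H; rewrite /fselect cardE.
have skip l v : o \notin l ->
    reaches (fseqs [seq fif (input_is o) (Fs o) | o <- l]) (h, v) (h, v) (size l).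
  elim: l => [_|a l IH] /=; first exact: reaches_skip.
  rewrite inE negb_or => /andP[oa ol].
  apply: (@reaches_seq _ _ _ (h, v) _ 0 _) (IH ol).
  by apply: reaches_ifF; rewrite input_isE -/o.
have: o \in enum {: option S} by rewrite mem_enum.
elim: (enum _) (enum_uniq {: option S}) => [|a l IH] //= /andP[al lu].
rewrite inE; have [ea _|oa /= ol] := eqVneq o a.
  have al' : o \notin l by rewrite ea.
  apply: reachesW (@reaches_seq _ _ _ (h, out') _ b.+1 _ _ (skip l _ al')).
    by rewrite addSnnS ltn_add2l -addnn; apply: leq_addr.
  by apply: reaches_ifT; rewrite -ea ?input_isE ?eqxx.
apply: reachesW (@reaches_seq _ _ _ (h, out) _ 0 _ _ (IH lu ol)).
  by rewrite add0n -addnS leq_add2l !doubleS.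
by apply: reaches_ifF; rewrite input_isE.
Qed.

End Fragments.

(** * From counter programs to polynomial-time functions *)

Section Boot.

Variables (S D : finType) (k : nat).

(** Work tapes are initially blank, whereas a counter needs the mark in cell 0; one preliminary step
    writes it on all counters at once. *)
Definition boot (F : frag S D k) : frag S D k :=
  @Frag _ _ _ (option (frag_state F)) None (fun q v =>
    match q with
    | None => Some (Some (frag_start F),
        [ffun i => (if is_counter i then Some (mark S D) else v i, Stay)])
    | Some q => if frag_delta q v is Some r then Some (Some r.1, r.2) else None
    end).

(** The strict inequality [b < p.[size w]] pays for the step added by [boot]. *)
Lemma polytime_frag (f : seq S -> seq D) (F : frag S D k) (p : {poly nat}) :
  (forall w, exists h b, reaches w F (nseq k.+1 0, [::]) (h, f w) b /\ b < p.[size w]%R) ->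
  polytime f.
Proof.
move=> FP; exists k.+1, (machine (boot F)), inl, (inr \o Some), p.
split=> [x y []//|x y []//|w]; have [h [b [[t [q [tb r hq]]] bp]]] := FP w.
exists t.+1.
have -> : tm_run (M := machine (boot F)) (map inl w) t.+1 =
    cf w (Some q : frag_state (boot F)) h (f w).
  rewrite /tm_run iterSr.
  have -> : tm_step (tm_init (M := machine (boot F)) (map inl w)) =
      cf w (Some (frag_start F) : frag_state (boot F)) (nseq k.+1 0) [::].
    rewrite /tm_step /tm_init /tm_next /cf /=.
    congr TmConf; apply: functional_extensionality => i; rewrite !ffunE /=.
      rewrite /tapes /is_counter; have [->|i0] := eqVneq i ord0.
        by apply: functional_extensionality => -[|j].
      have [im|im] := boolP (i == ord_max).
        by rewrite andbF; apply: functional_extensionality => -[|j].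
      by apply: functional_extensionality => j; case: eqP.
    by rewrite -[0 :: _]/(nseq k.+1 0) nth_nseq !if_same.
  by apply: run_iter; apply: (@run_map _ _ _ F (boot F) Some) r => /= q0 v r0 ->.
split.
- exact: leq_ltn_trans tb bp.
- by move: hq; rewrite /tm_halted !next_cf /= => ->.
- by move=> j; rewrite /= /tapes eqxx.
Qed.

End Boot.

(** * Functions bounded by polynomials *)

Definition poly_bounded (g : nat -> nat) : Prop :=
  exists p : {poly nat}, forall n, g n <= p.[n]%R.

Lemma poly_boundedW g g' : (forall n, g n <= g' n) -> poly_bounded g' -> poly_bounded g.
Proof. by move=> gg' [p pP]; exists p => n; apply: leq_trans (pP n). Qed.

Lemma poly_bounded_const c : poly_bounded (fun=> c).
Proof. by exists c%:P%R => n; rewrite hornerC. Qed.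

Lemma poly_bounded_id : poly_bounded id.
Proof. by exists 'X%R => n; rewrite hornerX. Qed.

Lemma poly_bounded_add g g' :
  poly_bounded g -> poly_bounded g' -> poly_bounded (fun n => g n + g' n).
Proof.
move=> [p pP] [q qP]; exists (p + q)%R => n; rewrite hornerD.
exact: leq_add (pP n) (qP n).
Qed.

Lemma poly_bounded_mul g g' :
  poly_bounded g -> poly_bounded g' -> poly_bounded (fun n => g n * g' n).
Proof.
move=> [p pP] [q qP]; exists (p * q)%R => n; rewrite hornerM.
exact: leq_mul (pP n) (qP n).
Qed.

Lemma poly_bounded_succ g : poly_bounded g -> poly_bounded (fun n => (g n).+1).
Proof.
move=> bg; apply: poly_boundedW (poly_bounded_add bg (poly_bounded_const 1)) => n.
by rewrite addn1.
Qed.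

Lemma poly_bounded_horner_rec (a : seq nat) : poly_bounded (horner_rec a).
Proof.
elim: a => [|c a IH] /=; first exact: poly_bounded_const.
apply: poly_bounded_add (poly_bounded_const c).
exact: poly_bounded_mul IH poly_bounded_id.
Qed.

(** * A program scheme: count the input, evaluate a polynomial, print in loops *)

Section Program.

Variables (S D : finType).

Notation frag := (frag S D 5).
Notation tape := 'I_7.
Notation em := (em D 5).

(** The registers are the input head, the input size, the value of the polynomial, a product under
    construction, a loop index and a scratch index for printing; tape 6 is the output. *)
Definition tIn : tape := ord0.
Definition tN : tape := @Ordinal 7 1 isT.
Definition tR : tape := @Ordinal 7 2 isT.
Definition tT : tape := @Ordinal 7 3 isT.
Definition tX : tape := @Ordinal 7 4 isT.
Definition tY : tape := @Ordinal 7 5 isT.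

Definition fcount : frag :=
  fwhile (predC (@input_is S D 5 None)) (fseq (fmove _ _ tIn MoveRight) (fmove _ _ tN MoveRight)).

Lemma reaches_count w out : reaches w fcount ([:: 0; 0; 0; 0; 0; 0], out)
  ([:: size w; size w; 0; 0; 0; 0], out) (size w * 5).
Proof.
apply: (@reaches_while _ _ _ _ _ _ (fun i => ([:: i; i; 0; 0; 0; 0], out)) (size w) 3).
- by move=> i iw; rewrite /= input_isE /=; move: iw; rewrite -onthTE; case: onth.
- by rewrite /= input_isE negbK /=; have := onthNE w (size w); rewrite leqnn; case: onth.
- move=> i iw; apply: (@reaches_seq _ _ _ _ _ _ _ ([:: i.+1; i; 0; 0; 0; 0], out) _ 1 1);
    exact: reaches_move.
Qed.

Definition frewind : frag := floop tN tX (fmove _ _ tIn MoveLeft).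

Lemma reaches_rewind w n out : reaches w frewind ([:: n; n; 0; 0; 0; 0], out)
  ([:: 0; n; 0; 0; 0; 0], out) (n * 13).+1.
Proof.
have := @reaches_loop _ _ _ w tN tX (fmove _ _ tIn MoveLeft)
  (fun i => [:: n - i; 0; 0; 0; 0; 0]) (fun=> out) n 1 isT isT isT.
rewrite /set2 /= subn0 subnn; apply=> i im; rewrite subnS.
exact: reaches_move.
Qed.

(** The product accumulates in [tT] while [tR] is consumed, and is then moved back to [tR]. *)
Definition fmul : frag :=
  fseq (fwhile (@nonzero S D 5 tR)
          (fseq (fmove _ _ tR MoveLeft) (floop tN tX (fmove _ _ tT MoveRight))))
       (fwhile (@nonzero S D 5 tT) (fseq (fmove _ _ tT MoveLeft) (fmove _ _ tR MoveRight))).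

Lemma reaches_mul w n r out : reaches w fmul ([:: 0; n; r; 0; 0; 0], out)
  ([:: 0; n; r * n; 0; 0; 0], out) (r * (n * 13 + 5) + r * n * 5).+1.
Proof.
apply: (@reaches_seq _ _ _ _ _ _ _ ([:: 0; n; 0; r * n; 0; 0], out)).
  have := @reaches_while _ _ _ w (@nonzero S D 5 tR)
    (fseq (fmove _ _ tR MoveLeft) (floop tN tX (fmove _ _ tT MoveRight)))
    (fun i => ([:: 0; n; r - i; i * n; 0; 0], out)) r (n * 13 + 3).
  rewrite subn0 subnn -!addnS; apply=> [i ir||i ir].
  - by rewrite nonzeroE //= -lt0n subn_gt0.
  - by rewrite nonzeroE.
  apply: reachesW (_ : (1 + (n * 13).+1).+1 <= _) _; first by lia.
  apply: (@reaches_seq _ _ _ _ _ _ _ ([:: 0; n; r - i.+1; i * n; 0; 0], out) _ 1).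
    by rewrite subnS; apply: reaches_move.
  have := @reaches_loop _ _ _ w tN tX (fmove _ _ tT MoveRight)
    (fun j => [:: 0; 0; r - i.+1; i * n + j; 0; 0]) (fun=> out) n 1 isT isT isT.
  rewrite /set2 /= addn0 mulSnr; apply=> j jn; rewrite addnS.
  exact: reaches_move.
have := @reaches_while _ _ _ w (@nonzero S D 5 tT)
  (fseq (fmove _ _ tT MoveLeft) (fmove _ _ tR MoveRight))
  (fun i => ([:: 0; n; i; r * n - i; 0; 0], out)) (r * n) 3.
rewrite subn0 subnn; apply=> [i ir||i ir].
- by rewrite nonzeroE //= -lt0n subn_gt0.
- by rewrite nonzeroE.
apply: (@reaches_seq _ _ _ _ _ _ _ ([:: 0; n; i; r * n - i.+1; 0; 0], out) _ 1 1).
  by rewrite subnS; apply: reaches_move.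
exact: reaches_move.
Qed.

Definition fadd (c : nat) : frag := fseqs (nseq c (fmove _ _ tR MoveRight)).

Lemma reaches_add w c n r out : reaches w (fadd c) ([:: 0; n; r; 0; 0; 0], out)
  ([:: 0; n; r + c; 0; 0; 0], out) (c * 2).
Proof.
elim: c r => [|c IH] r; first by rewrite addn0; apply: reaches_skip.
rewrite -addSnnS; apply: (@reaches_seq _ _ _ _ _ _ _ _ _ 1 _ _ (IH r.+1)).
exact: reaches_move.
Qed.

Fixpoint fhorner (a : seq nat) : frag :=
  if a is c :: a' then fseq (fhorner a') (fseq fmul (fadd c)) else fskip S D 5.

Lemma reaches_horner (a : seq nat) : exists2 b, poly_bounded b &
  forall w n out, reaches w (fhorner a) ([:: 0; n; 0; 0; 0; 0], out)
    ([:: 0; n; horner_rec a n; 0; 0; 0], out) (b n).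
Proof.
elim: a => [|c a [b bb IH]] /=.
  by exists (fun=> 0); [apply: poly_bounded_const|move=> *; apply: reaches_skip].
pose r := horner_rec a.
exists (fun n => (b n + ((r n * (n * 13 + 5) + r n * n * 5).+1 + c * 2).+1).+1).
  have br : poly_bounded r := poly_bounded_horner_rec a.
  do ?[exact: br|exact: bb|apply: poly_bounded_succ|apply: poly_bounded_add
      |apply: poly_bounded_mul|apply: poly_bounded_const|exact: poly_bounded_id].
move=> w n out; apply: reaches_seq (IH _ _ _) _.
by apply: reaches_seq (reaches_mul _ _ _ _) _; apply: reaches_add.
Qed.

Lemma reaches_loopX w (r : tape) m (F : frag) (H : nat -> seq nat) (o : nat -> seq D) b :
  is_counter r -> is_counter tX -> r != tX ->
  (forall i out, i < m -> reaches w F (set2 r tX (H i) (m - i.+1) i, out)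
                        (set2 r tX (H i.+1) (m - i.+1) i, out ++ o i) b) ->
  forall out, reaches w (floop r tX F) (set2 r tX (H 0) m 0, out)
    (set2 r tX (H m) m 0, out ++ flatten [seq o i | i <- iota 0 m]) (m * (b + 12)).+1.
Proof.
move=> rc xc rx FP out.
have := @reaches_loop S D 5 w r tX F H
  (fun i => out ++ flatten [seq o i | i <- iota 0 i]) m b rc xc rx.
rewrite [flatten [seq _ | _ <- iota 0 0]]/= cats0; apply=> i im.
have -> : flatten [seq o i | i <- iota 0 i.+1] = flatten [seq o i | i <- iota 0 i] ++ o i.
  by rewrite -[in LHS]addn1 iotaD map_cat flatten_cat /= cats0.
by rewrite catA; apply: FP.
Qed.

Variables (es1 es2 es3 : seq em) (esI esX : option S -> seq em).
Variable (a : seq nat).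

(** Within a loop the running counter is partly consumed: [tN] holds [n - x.+1], or [tR] holds
    [r - x.+1]. Blocks printed there should refer to the index in [tX] instead. The last loop reads
    positions 1 to n, and position n is blank. *)
Definition em_text (w : seq S) : seq D :=
  let n := size w in let r := horner_rec a n in
  emsval [:: 0; n; r; 0; 0; 0] es1 ++
  (flatten [seq emsval [:: 0; n - x.+1; r; 0; x; 0] es2 | x <- iota 0 n] ++
  (flatten [seq emsval [:: 0; n; r - x.+1; 0; x; 0] es3 | x <- iota 0 r] ++
  (emsval [:: 0; n; r; 0; 0; 0] (esI (onth w 0)) ++
  flatten [seq emsval [:: x.+1; n - x.+1; r; 0; x; 0] (esX (onth w x.+1))
    | x <- iota 0 n]))).

Hypothesis wf1 : all (em_wf tY) es1.
Hypothesis wf2 : all (em_wf tY) es2.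
Hypothesis wf3 : all (em_wf tY) es3.
Hypothesis wfI : forall o, all (em_wf tY) (esI o).
Hypothesis wfX : forall o, all (em_wf tY) (esX o).

Definition fmain : frag :=
  fseqs [:: fcount; frewind; fhorner a; @fems S D 5 tY es1; floop tN tX (@fems S D 5 tY es2);
    floop tR tX (@fems S D 5 tY es3); fselect (fun o => @fems S D 5 tY (esI o));
    fmove _ _ tIn MoveRight;
    floop tN tX (fseq (fselect (fun o => @fems S D 5 tY (esX o))) (fmove _ _ tIn MoveRight))].

Lemma polytime_em_text : polytime em_text.
Proof.
have [b bb hornerP] := reaches_horner a.
pose r := horner_rec a.
pose cI := \max_o ems_cost (esI o); pose cX := \max_o ems_cost (esX o).
pose K := (#|{: option S}|.+1).*2.
pose B n := n + r n + 1.
pose costX n := (1 + ((n * ((cX * (B n).+1 + K + 1).+1 + 12)).+1 + 0).+1).+1.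
pose costI n := (cI * (B n).+1 + K + costX n).+1.
pose cost3 n := ((r n * (ems_cost es3 * (B n).+1 + 12)).+1 + costI n).+1.
pose cost2 n := ((n * (ems_cost es2 * (B n).+1 + 12)).+1 + cost3 n).+1.
pose cost n := (n * 5 + ((n * 13).+1 + (b n + (ems_cost es1 * (B n).+1 + cost2 n).+1).+1).+1).+2.
have [p pP] : poly_bounded cost.
  have br : poly_bounded r := poly_bounded_horner_rec a.
  rewrite /cost /cost2 /cost3 /costI /costX /B.
  do ?[exact: br|exact: bb|apply: poly_bounded_succ|apply: poly_bounded_add
      |apply: poly_bounded_mul|apply: poly_bounded_const|exact: poly_bounded_id].
apply: (@polytime_frag _ _ _ _ fmain p) => w; set n := size w.
(* [cost] carries one successor more than the program takes, which yields the strict bound required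
   by [polytime_frag]. *)
exists [:: n.+1; n; r n; 0; 0; 0], (cost n).-1; split; last exact: leq_trans (pP n).
rewrite /em_text -/n -/(r n).
apply: reaches_seq (reaches_count _ _) _.
apply: reaches_seq (reaches_rewind _ _ _) _.
apply: reaches_seq (hornerP _ _ _) _; rewrite -/(r n).
have nB m : m <= n -> m <= B n.
  by move=> mn; rewrite /B -addnA; apply: leq_trans mn (leq_addr _ _).
have rB m : m <= r n -> m <= B n.
  by move=> mr; rewrite /B addnAC; apply: leq_trans mr (leq_addl _ _).
have nB1 m : m <= n -> m.+1 <= B n.
  by move=> mn; rewrite /B addn1 ltnS; apply: leq_trans mn (leq_addr _ _).
have hdP a0 b0 c0 d0 : a0 <= B n -> b0 <= B n -> c0 <= B n -> d0 <= B n ->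
    forall i, nth 0 [:: a0; b0; c0; 0; d0; 0] i <= B n.
  by move=> ha hb hc hd [|[|[|[|[|[|i]]]]]] //=; rewrite nth_nil.
have nn : n <= B n by apply: nB.
have rr : r n <= B n by apply: rB.
have sn x : n - x <= B n by apply: nB; apply: leq_subr.
have sr x : r n - x <= B n by apply: rB; apply: leq_subr.
have emsP es h out : all (em_wf tY) es -> size h = 6 -> nth 0 h 5 = 0 ->
    (forall i, nth 0 h i <= B n) ->
    reaches w (@fems S D 5 tY es) (h, out) (h, out ++ emsval h es) (ems_cost es * (B n).+1).
  by move=> *; apply: reaches_ems.
apply: reaches_seq (emsP _ _ _ wf1 _ _ _) _ => //.
  exact: hdP.
rewrite catA; apply: reaches_seq.
  have := @reaches_loopX w tN n (@fems S D 5 tY es2) (fun=> [:: 0; 0; r n; 0; 0; 0])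
    (fun x => emsval [:: 0; n - x.+1; r n; 0; x; 0] es2) (ems_cost es2 * (B n).+1) isT isT isT.
  apply=> x out xn; apply: emsP => //.
  by apply: hdP => //; apply: nB; apply: ltnW.
rewrite catA; apply: reaches_seq.
  have := @reaches_loopX w tR (r n) (@fems S D 5 tY es3) (fun=> [:: 0; n; 0; 0; 0; 0])
    (fun x => emsval [:: 0; n; r n - x.+1; 0; x; 0] es3) (ems_cost es3 * (B n).+1) isT isT isT.
  apply=> x out xn; apply: emsP => //.
  by apply: hdP => //; apply: rB; apply: ltnW.
rewrite catA; apply: reaches_seq.
  apply: reaches_select; apply: reachesW (emsP _ _ _ _ _ _ _) => //.
    by rewrite leq_mul2r; apply/orP; right; apply: (leq_bigmax (onth w 0)).
  exact: hdP.
apply: reaches_seq; first exact: reaches_move.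
apply: reaches_seq; last exact: reaches_skip.
have := @reaches_loopX w tN n _ (fun x => [:: x.+1; 0; r n; 0; 0; 0])
    (fun x => emsval [:: x.+1; n - x.+1; r n; 0; x; 0] (esX (onth w x.+1)))
    (cX * (B n).+1 + K + 1).+1 isT isT isT.
apply=> x out xn; apply: reaches_seq; last first.
  have := @reaches_move S D 5 w tIn MoveRight [:: x.+1; n - x.+1; r n; 0; x; 0]
    (out ++ emsval [:: x.+1; n - x.+1; r n; 0; x; 0] (esX (onth w x.+1))).
  exact.
apply: reaches_select; apply: reachesW (emsP _ _ _ _ _ _ _) => //.
  by rewrite leq_mul2r; apply/orP; right; apply: (leq_bigmax (onth w x.+1)).
by apply: hdP => //; [apply: nB1|apply: nB]; apply: ltnW.
Qed.

End Program.

(** * The game and its net *)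

Definition bits_val (s : seq bool) : nat := foldr (fun (b : bool) v => b + v.*2) 0 s.

Lemma nat_bits_val (s : seq bool) : last true s -> nat_bits (bits_val s) = s.
Proof.
suff posP (b : bool) s' : last b s' ->
    exists2 p, pos_bits p = b :: s' & nat_of_pos p = bits_val (b :: s').
  case: s => // b s bs; have [p pb pv] := posP b s bs.
  by rewrite -pv -pb /nat_bits -[nat_of_pos p]/(nat_of_bin (Npos p)) nat_of_binK.
elim: s' b => [|c s' IH] b /=; first by case: b => // _; exists xH.
case/IH=> p pb pv; case: b.
  by exists (xI p); rewrite /= ?pb // !natTrecE pv.
by exists (xO p); rewrite /= ?pb // !natTrecE pv.
Qed.

Lemma bits_val_cat s t : bits_val (s ++ t) = bits_val s + bits_val t * 2 ^ size s.
Proof. by elim: s => [|b s IH] /=; rewrite ?muln1 // IH expnS; lia. Qed.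

Lemma bits_val_nseq b n : bits_val (nseq n b) = b * (2 ^ n).-1.
Proof.
elim: n => [|n IH] /=; rewrite ?muln0 // IH expnS.
by have := expn_gt0 2 n; case: (b); lia.
Qed.

(** * From nets with structured control states to numbered instances *)

Section Transfer.

Variables (Q A : eqType) (fq : Q -> nat) (fa : A -> nat).
Hypotheses (fq_inj : injective fq) (fa_inj : injective fa).
Variables (nq na : nat) (rules : seq (Q * A * int * Q)).

Definition bounded_rule (r : Q * A * int * Q) :=
  [&& fq r.1.1.1 <= nq, fa r.1.1.2 <= na & fq r.2 <= nq].

Hypothesis rules_bounded : all bounded_rule rules.

Definition rule_lts : lts :=
  @Lts (Q * nat)%type A (fun a c d => (c.1, a, (d.2%:Z - c.2%:Z)%R, d.1) \in rules).

Definition num_rule (r : Q * A * int * Q) : 'I_nq.+1 * 'I_na.+1 * int * 'I_nq.+1 :=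
  (inord (fq r.1.1.1), inord (fa r.1.1.2), r.1.2, inord (fq r.2)).

Definition num (c : Q * nat) : 'I_nq.+1 * nat := (inord (fq c.1), c.2).

Definition rule_instance (c d : Q * nat) : instance :=
  @Instance nq.+1 na.+1 (map num_rule rules) (num c) (num d).

Lemma inord_inj n i j : i <= n -> j <= n -> inord i = inord j :> 'I_n.+1 -> i = j.
Proof. by move=> li lj /(congr1 val); rewrite /= !inordK. Qed.

Variables c0 d0 : Q * nat.

Notation I := (rule_instance c0 d0).
Notation T := (socn_lts (inst_socn I)).

Lemma num_transP (c : Q * nat) a' (x : lts_state T) : fq c.1 <= nq ->
  @lts_trans T a' (num c) x -> exists (a : A) (d : Q * nat),
    [/\ a' = inord (fa a), fa a <= na, x = num d, fq d.1 <= nq & @lts_trans rule_lts a c d].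
Proof.
move=> cq; rewrite /= inE /= => /mapP[[[[q a] z] q'] rin []].
have /= := allP rules_bounded _ rin => /and3P[/= bq ba bq'].
move=> /inord_inj-/(_ cq bq)/fq_inj eq -> ez xq'; exists a, (q', x.2); split=> //.
  by case: x xq' {ez} => x1 x2 /= ->.
by rewrite /= eq ez.
Qed.

Lemma trans_num (c d : Q * nat) (a : A) : @lts_trans rule_lts a c d ->
  @lts_trans T (inord (fa a)) (num c) (num d) /\ fq d.1 <= nq /\ fa a <= na.
Proof.
move=> /= rin; split; last by have /= := allP rules_bounded _ rin => /and3P[/= _ ? ?].
by rewrite inE /=; apply/mapP; exists (c.1, a, (d.2%:Z - c.2%:Z)%R, d.1).
Qed.

(** The image of a bisimulation, restricted to control states with small numbers, is again one:
    rules lead to small numbers only, on which the numbering is injective. *)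
Lemma bisim_num (c d : Q * nat) : fq c.1 <= nq -> fq d.1 <= nq ->
  @bisim_equiv rule_lts c d -> @bisim_equiv T (num c) (num d).
Proof.
move=> cq dq [R [[R1 R2] Rcd]].
exists (fun x y => exists c d, [/\ x = num c, y = num d, fq c.1 <= nq, fq d.1 <= nq & R c d]).
split; last by exists c, d.
split=> _ _ [{cq Rcd} {}c [{dq} {}d [-> -> cq dq Rcd]]] a' x.
  move=> /(num_transP cq)[a [c' [-> _ -> c'q tr]]].
  have [d' [tr' Rcd']] := R1 _ _ Rcd _ _ tr; have [tr'' [d'q _]] := trans_num tr'.
  by exists (num d'); split=> //; exists c', d'.
move=> /(num_transP dq)[a [d' [-> _ -> d'q tr]]].
have [c' [tr' Rcd']] := R2 _ _ Rcd _ _ tr; have [tr'' [c'q _]] := trans_num tr'.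
by exists (num c'); split=> //; exists c', d'.
Qed.

(** Here the inverse image is taken. The answer comes from an action with the same number, and
    injectivity of [fa] makes it the same action. *)
Lemma sim_num (c d : Q * nat) : fq c.1 <= nq -> fq d.1 <= nq ->
  @sim_preorder T (num c) (num d) -> @sim_preorder rule_lts c d.
Proof.
move=> cq dq [R [Rsim Rcd]].
exists (fun c d => [/\ fq c.1 <= nq, fq d.1 <= nq & R (num c) (num d)]); split=> //.
move=> {cq dq Rcd} {}c {}d [cq dq Rcd] a c' tr.
have [tr' [c'q aq]] := trans_num tr.
have [x [/(num_transP dq)[a2 [d' [e a2q -> d'q tr2]]] R']] := Rsim _ _ Rcd _ _ tr'.
have ea : a = a2 by apply: fa_inj; apply: inord_inj e.
by exists d'; split=> //; rewrite ea.
Qed.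

End Transfer.

Notation weight V := ((bool + V) + (option bool * V))%type.

(* [inl (inl b)] is 0 or 1, [inl (inr v)] is -2^v, and [inr (j, v)] is
   -(2^(v+1) + j) with [j] read in {-1, 0, 1}. *)
Definition weight_int (z : weight nat) : int :=
  match z with
  | inl (inl b) => b%:Z
  | inl (inr v) => - (2 ^ v)%:Z
  | inr (None, v) => - (2 ^ v.+1)%:Z
  | inr (Some true, v) => - (2 ^ v.+1).+1%:Z
  | inr (Some false, v) => - (2 ^ v.+1).-1%:Z
  end%R.

(* [None] is the marker in front of each row of the computation table. *)
Notation cell M := (option (option (tm_sym M) * option (tm_state M)))%type.
Notation triple M := (cell M * cell M * cell M)%type.

(* Positions of the attacker: [inl None] guesses a cell index by increments,
   [inl (Some c)] claims that the counter is the index of a cell with content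
   [c], and [inr (f, v)] claims that the counter is [v] if [f = Some true],
   that it lies in [v, v + 2^R) if [f = Some false], and in [0, 2^v) if
   [f = None]. *)
Notation position M V := (option (cell M) + option bool * V)%type.

(* [inl (b, e)] are the two copies of the position [e], [inr (Some (t, o))] the
   defender-choice gadget of [t], and [inr None] a dead state. *)
Notation ctrl M V :=
  (bool * position M V + option (triple M * option (option bool)))%type.
Notation tag_act M := (triple M + cell M + option bool)%type.
Notation act M V := (tag_act M + unit * V)%type.
Notation rule M V := (ctrl M V * act M V * weight V * ctrl M V)%type.
Notation erule M V := (position M V * act M V * weight V * position M V)%type.

Notation static_ctrl M :=
  (bool * option (cell M) + option (triple M * option (option bool)))%type.
Notation chain := (bool * option bool)%type.

(** * The local rule of computation tables, and the net *)

Section Net.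

Variable M : tm 0.
Variable acc : pred (tm_state M).

Definition delta1 (q : tm_state M) (s : option (tm_sym M)) := tm_delta q [ffun=> s].

(** The final theorem takes for [acc] the complement of the accepting states, so the cells sought by
    the attacker are rejecting ones. *)
Definition accepting (c : cell M) : bool :=
  if c is Some (s, Some q) then if delta1 q s is None then acc q else false else false.

Definition arriving (m : move) (c : cell M) : option (tm_state M) :=
  if c is Some (s, Some q) then
    if delta1 q s is Some (q', a) then
      match m, (a ord0).2 with
      | MoveLeft, MoveLeft | MoveRight, MoveRight => Some q'
      | _, _ => None
      end
    else None
  else None.

(** A marker on the left reveals the first tape cell, where a left move keeps the head in place. A
    halted cell is copied, so the table continues after the halt. *)
Definition next_cell (t : triple M) : cell M :=
  let: (x, y, z) := t in
  match y with
  | None => None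
  | Some (s, Some q) =>
      if delta1 q s is Some (q', a) then
        Some ((a ord0).1,
          match (a ord0).2 with
          | MoveLeft => if x is None then Some q' else None
          | Stay => Some q'
          | MoveRight => None
          end)
      else y
  | Some (s, None) =>
      Some (s, if arriving MoveRight x is Some q then Some q else arriving MoveLeft z)
  end.

Definition pick3 (j : option bool) (t : triple M) : cell M :=
  let: (x, y, z) := t in
  match j with Some true => x | None => y | Some false => z end.

(** * Rule schemes, generic in the type [V] of indices: numbers for the net, counter expressions for
    the printer *)

Section Rules.

Variables (V : Type).

Definition claim (c : cell M) : position M V := inl (Some c).
Definition aTriple (t : triple M) : act M V := inl (inl (inl t)).
Definition aCell (c : cell M) : act M V := inl (inl (inr c)).
Definition aTag (j : option bool) : act M V := inl (inr j).
Definition aIndex (v : V) : act M V := inr (tt, v).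
Definition wBool (b : bool) : weight V := inl (inl b).
Definition wPow (v : V) : weight V := inl (inr v).
Definition wRow (j : option bool) (v : V) : weight V := inr (j, v).
Definition exactly (v : V) : position M V := inr (Some true, v).
Definition window (v : V) : position M V := inr (Some false, v).
Definition below (v : V) : position M V := inr (None, v).

Definition guess_rules : seq (erule M V) :=
  (inl None, aTag None, wBool true, inl None) ::
  [seq (inl None, aCell c, wBool false, claim c) | c <- enum {: cell M} & accepting c].

Definition marker_rules (v0 vR : V) : seq (erule M V) :=
  [:: (claim None, aTag None, wRow None vR, claim None);
      (claim None, aTag (Some true), wBool false, exactly v0)].

(* The blank part of row 0 is the union of [n+2, n+2+2^R) and [2^R, 2^(R+1)). *)
Definition blank_rules (vn2 vR : V) : seq (erule M V) :=
  [:: (claim (Some (None, None)), aTag None, wBool false, window vn2);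
      (claim (Some (None, None)), aTag (Some true), wPow vR, below vR)].

Definition window0_rules (v0 vR : V) : seq (erule M V) :=
  [:: (window v0, aTag None, wBool false, below vR)].

Definition count_rules (v0 v' v : V) : seq (erule M V) :=
  [:: (exactly v', aTag None, wPow v0, exactly v); (window v', aTag None, wPow v0, window v)].

(** A number is below 2^(v+1) iff it is below 2^v, possibly after subtraction of 2^v. *)
Definition bit_rules (v' v : V) : seq (erule M V) :=
  [:: (below v', aTag None, wBool false, below v);
      (below v', aTag (Some true), wPow v, below v)].

(** The index belongs to the action; otherwise the defender could answer with another position that
    carries the same letter. *)
Definition input_rules (c : cell M) (v v' : V) : seq (erule M V) :=
  [:: (claim c, aIndex v, wBool false, exactly v')].

Definition mirror (r : erule M V) : seq (rule M V) :=
  let: (e, a, z, e') := r in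
  [seq (inl (b, e), a, z, inl (b, e')) | b <- [:: false; true]].

Definition tags : seq (option bool) := [:: None; Some true; Some false].

(** The first copy enters the undecided state [(t, None)], and the second must answer with some
    [(t, Some j)]. Tag [j] then leads to the two copies of the claim on the letter [j], while any
    other tag brings both components to the same configuration. The first copy may also enter
    [(t, Some j)], so that it can match every move of the second. *)
Definition gadget_rules (vR : V) (t : triple M) : seq (rule M V) :=
  [:: (inl (false, claim (next_cell t)), aTriple t, wBool false, inr (Some (t, None)))] ++
  [seq (inl (b, claim (next_cell t)), aTriple t, wBool false, inr (Some (t, Some j)))
    | b <- [:: false; true], j <- tags] ++
  [seq (inr (Some (t, None)), aTag i, wRow i vR, inl (false, claim (pick3 i t))) | i <- tags] ++
  [seq (inr (Some (t, Some j)), aTag i, wRow i vR, inl (i == j, claim (pick3 i t)))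
    | j <- tags, i <- tags].

Definition zero_rules (v0 : V) : seq (rule M V) :=
  [:: (inl (false, exactly v0), aTag None, wBool false, inr None);
      (inl (true, exactly v0), aTag None, wPow v0, inr None);
      (inl (false, below v0), aTag None, wBool false, inr None);
      (inl (true, below v0), aTag None, wPow v0, inr None)].

Definition static_erules (v0 vR vn vn1 vn2 : V) : seq (erule M V) :=
  guess_rules ++ marker_rules v0 vR ++ blank_rules vn2 vR ++ window0_rules v0 vR ++
  count_rules v0 vn1 vn ++ count_rules v0 vn2 vn1.

(** Triples with a marker in the middle are left out: claims of a marker are checked by
    [marker_rules]. *)
Definition choice_rules (v0 vR : V) : seq (rule M V) :=
  flatten [seq gadget_rules vR t | t <- enum {: triple M} & t.1.2 != None] ++ zero_rules v0.

Definition mirrors (es : seq (erule M V)) : seq (rule M V) := flatten (map mirror es).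

End Rules.

Variables (w : seq (tm_sym M)) (R : nat).

Notation n := (size w).

Definition first_cell (o : option (tm_sym M)) : cell M := Some (o, Some (tm_start M)).
Definition tape_cell (o : option (tm_sym M)) : cell M := Some (o, None).

(** The rules come in the order in which [em_text] prints them; [net_erules] collects the attacker's
    rules before mirroring. *)
Definition net_rules : seq (rule M nat) :=
  (mirrors (static_erules 0 R n n.+1 n.+2) ++ choice_rules 0 R) ++
  (flatten [seq mirrors (count_rules 0 x.+1 x) | x <- iota 0 n] ++
  (flatten [seq mirrors (bit_rules x.+1 x) | x <- iota 0 R] ++
  (mirrors (input_rules (first_cell (onth w 0)) 0 1) ++
  flatten [seq mirrors (input_rules (tape_cell (onth w x.+1)) x.+1 x.+2) | x <- iota 0 n]))).

Definition net_erules : seq (erule M nat) :=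
  static_erules 0 R n n.+1 n.+2 ++
  flatten [seq count_rules 0 x.+1 x | x <- iota 0 n] ++
  flatten [seq bit_rules x.+1 x | x <- iota 0 R] ++
  input_rules (first_cell (onth w 0)) 0 1 ++
  flatten [seq input_rules (tape_cell (onth w x.+1)) x.+1 x.+2 | x <- iota 0 n].

Lemma mem_net_rules r :
  (r \in net_rules) = (r \in mirrors net_erules) || (r \in choice_rules 0 R).
Proof.
have fl (f : nat -> seq (erule M nat)) l :
    mirrors (flatten [seq f x | x <- l]) = flatten [seq mirrors (f x) | x <- l].
  by elim: l => //= x l IH; rewrite /mirrors map_cat flatten_cat -[X in _ ++ X]/(mirrors _) IH.
have cat (l1 l2 : seq (erule M nat)) : mirrors (l1 ++ l2) = mirrors l1 ++ mirrors l2.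
  by rewrite /mirrors map_cat flatten_cat.
rewrite /net_rules /net_erules (cat (static_erules _ _ _ _ _)).
move: (mirrors (static_erules _ _ _ _ _)) (choice_rules 0 R) => s1 s2.
rewrite cat fl cat fl cat fl; move: (flatten _) (flatten _) (mirrors _) (flatten _).
move=> s3 s4 s5 s6; rewrite !mem_cat.
by case: (r \in s1) (r \in s2) => -[]; rewrite ?orbT ?orbF.
Qed.

Lemma mem_mirrors (b : bool) e a z (q : ctrl M nat) es :
  (inl (b, e), a, z, q) \in mirrors es <->
  exists2 e', q = inl (b, e') & (e, a, z, e') \in es.
Proof.
split.
  case/flatten_mapP=> -[[[e1 a1] z1] e1'] rin /=.
  by rewrite !inE => /orP[]/eqP[-> -> -> -> ->]; exists e1'.
move=> [e' -> rin]; apply/flatten_mapP; exists (e, a, z, e') => //=.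
by rewrite !inE; case: b; rewrite eqxx ?orbT.
Qed.

(** This records that position and action determine an attacker rule. The function is defined on
    more pairs than there are rules; only its agreement with the rules matters. *)
Definition emove (e : position M nat) (a : act M nat) : option (weight nat * position M nat) :=
  match e, a with
  | inl None, inl (inl (inr c)) => Some (wBool _ false, claim _ c)
  | inl None, inl (inr None) => Some (wBool _ true, inl None)
  | inl (Some None), inl (inr None) => Some (wRow None R, claim _ None)
  | inl (Some None), inl (inr (Some _)) => Some (wBool _ false, exactly 0)
  | inl (Some _), inl (inr None) => Some (wBool _ false, window n.+2)
  | inl (Some _), inl (inr (Some _)) => Some (wPow R, below R)
  | inl (Some _), inr (_, v) => Some (wBool _ false, exactly v.+1)
  | inr (Some true, v.+1), _ => Some (wPow 0, exactly v)
  | inr (Some false, v.+1), _ => Some (wPow 0, window v)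
  | inr (Some false, 0), _ => Some (wBool _ false, below R)
  | inr (None, v.+1), inl (inr None) => Some (wBool _ false, below v)
  | inr (None, v.+1), _ => Some (wPow v, below v)
  | _, _ => None
  end.

Lemma net_erulesP e a z e' : (e, a, z, e') \in net_erules -> emove e a = Some (z, e') /\ 
  forall t, a <> aTriple _ t.
Proof.
rewrite /net_erules /static_erules !mem_cat => /orP[|].
  case/orP=> [|].
    by rewrite inE => /orP[/eqP[-> -> -> ->]//|/mapP[c _ [-> -> -> ->]]].
  case/orP=> [|]; first by rewrite !inE => /orP[]/eqP[-> -> -> ->].
  case/orP=> [|]; first by rewrite !inE => /orP[]/eqP[-> -> -> ->].
  case/orP=> [|]; first by rewrite !inE => /eqP[-> -> -> ->].
  by case/orP=> [|]; rewrite !inE => /orP[]/eqP[-> -> -> ->].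
case/orP=> [|]; first by case/flatten_mapP=> x _; rewrite !inE => /orP[]/eqP[-> -> -> ->].
case/orP=> [|]; first by case/flatten_mapP=> x _; rewrite !inE => /orP[]/eqP[-> -> -> ->].
case/orP=> [|]; first by rewrite !inE => /eqP[-> -> -> ->].
by case/flatten_mapP=> x _; rewrite !inE => /eqP[-> -> -> ->].
Qed.

Lemma choice_rulesP (q : ctrl M nat) a z q' :
  (q, a, z, q') \in choice_rules 0 R ->
  (exists t j, [/\ t.1.2 != None, a = aTriple _ t, z = wBool _ false &
     (exists b, q = inl (b, claim _ (next_cell t)) /\ q' = inr (Some (t, Some j))) \/
     (q = inl (false, claim _ (next_cell t)) /\ q' = inr (Some (t, None)))]) \/
  (exists t i, [/\ a = aTag _ i, z = wRow i R &
     (q = inr (Some (t, None)) /\ q' = inl (false, claim _ (pick3 i t))) \/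
     (exists j, q = inr (Some (t, Some j)) /\ q' = inl (i == j, claim _ (pick3 i t)))]) \/
  (exists b, [/\ a = aTag _ None, z = (if b then wPow 0 else wBool _ false), q' = inr None &
     q = inl (b, exactly 0) \/ q = inl (b, below 0)]).
Proof.
rewrite /choice_rules mem_cat => /orP[/flatten_mapP[t]|].
  rewrite mem_filter => /andP[tP _].
  rewrite mem_cat => /orP[|].
    rewrite mem_seq1 => /eqP[-> -> -> ->].
    by left; exists t, None; split=> //; right.
  rewrite mem_cat => /orP[|].
    move=> /allpairsP[[b j] [_ _ [-> -> -> ->]]].
    by left; exists t, j; split=> //; left; exists b.
  rewrite mem_cat => /orP[|].
    move=> /mapP[i _ [-> -> -> ->]].
    by right; left; exists t, i; split=> //; left.
  move=> /allpairsP[[j i] [_ _ [-> -> -> ->]]].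
  by right; left; exists t, i; split=> //; right; exists j.
rewrite !inE => /or4P[]/eqP[-> -> -> ->]; right; right.
- by exists false; split=> //; left.
- by exists true; split=> //; left.
- by exists false; split=> //; right.
- by exists true; split=> //; right.
Qed.

Lemma mem_tags j : j \in tags. Proof. by case: j => [[]|]. Qed.

Lemma gadget_mem (t : triple M) r : t.1.2 != None -> r \in gadget_rules R t -> r \in net_rules.
Proof.
move=> tP rin; rewrite mem_net_rules; apply/orP; right; rewrite mem_cat; apply/orP; left.
by apply/flatten_mapP; exists t; rewrite // mem_filter tP mem_enum.
Qed.

Lemma mem_enter (t : triple M) : t.1.2 != None ->
  (inl (false, claim _ (next_cell t)), aTriple _ t, wBool _ false, inr (Some (t, None)))
    \in net_rules.
Proof. by move=> tP; apply: (gadget_mem tP); rewrite mem_cat inE eqxx. Qed.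

Lemma mem_decoy (t : triple M) b j : t.1.2 != None ->
  (inl (b, claim _ (next_cell t)), aTriple _ t, wBool _ false, inr (Some (t, Some j)))
    \in net_rules.
Proof.
move=> tP; apply: (gadget_mem tP); rewrite mem_cat; apply/orP; right.
rewrite mem_cat; apply/orP; left; apply/allpairsP.
by exists (b, j); rewrite mem_tags; case: b.
Qed.

Lemma mem_pick (t : triple M) i : t.1.2 != None ->
  (inr (Some (t, None)), aTag _ i, wRow i R, inl (false, claim _ (pick3 i t))) \in net_rules.
Proof.
move=> tP; apply: (gadget_mem tP); do 2!(rewrite mem_cat; apply/orP; right).
rewrite mem_cat; apply/orP; left; apply/mapP.
by exists i; rewrite ?mem_tags.
Qed.

Lemma mem_decoy_pick (t : triple M) i j : t.1.2 != None ->
  (inr (Some (t, Some j)), aTag _ i, wRow i R, inl (i == j, claim _ (pick3 i t))) \in net_rules.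
Proof.
move=> tP; apply: (gadget_mem tP); do 3!(rewrite mem_cat; apply/orP; right).
apply/allpairsP.
by exists (j, i); rewrite !mem_tags.
Qed.

Lemma mem_eve b e a z e' : (e, a, z, e') \in net_erules ->
  (inl (b, e), a, z, inl (b, e')) \in net_rules.
Proof. by move=> rin; rewrite mem_net_rules; apply/orP; left; apply/mem_mirrors; exists e'. Qed.

Definition int_rule (r : rule M nat) : ctrl M nat * act M nat * int * ctrl M nat :=
  (r.1.1.1, r.1.1.2, weight_int r.1.2, r.2).

Definition net_lts := rule_lts (map int_rule net_rules).

Lemma net_transP (q q' : ctrl M nat) m m' a :
  @lts_trans net_lts a (q, m) (q', m') <->
  exists2 z, (q, a, z, q') \in net_rules & (m'%:Z - m%:Z)%R = weight_int z.
Proof.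
split; first by case/mapP=> -[[[q1 a1] z1] q1'] rin /= [-> -> -> ->]; exists z1.
by move=> [z rin ez]; apply/mapP; exists (q, a, z, q'); rewrite //= /int_rule /= ez.
Qed.

(* [win e m] says that the claim made by the attacker at [e] holds for [m];
   [C] lists the contents of the cells. *)
Variable C : nat -> cell M.

Notation L := (2 ^ R.+1).

Definition win (e : position M nat) (m : nat) : Prop :=
  match e with
  | inl None => exists2 i, m <= i & accepting (C i)
  | inl (Some c) => C m = c
  | inr (Some true, v) => m = v
  | inr (Some false, v) => v <= m < v + 2 ^ R
  | inr (None, v) => m < 2 ^ v
  end.

(** * False claims yield bisimilar pairs *)

Hypothesis size_w : n.+2 <= 2 ^ R.
Hypothesis C_marker : forall i, (C i == None) = (i %% L == 0).
Hypothesis C_first : C 1 = first_cell (onth w 0).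
Hypothesis C_row0 : forall i, 0 < i -> i.+1 < L -> C i.+1 = tape_cell (onth w i).
Hypothesis C_next : forall i, L <= i -> i %% L != 0 ->
  C i = next_cell (C (i - L.+1), C (i - L), C (i - L.-1)).

Lemma C_blank i : n.+2 <= i < L -> C i = Some (None, None).
Proof.
case: i => // -[|i] // /andP[ni iL]; rewrite C_row0 //.
by have := onthNE w i.+1; rewrite leqW //; case: onth.
Qed.

Lemma L_double : L = 2 ^ R + 2 ^ R.
Proof. by rewrite expnS mul2n addnn. Qed.

(** Read contrapositively, this keeps the attacker among false claims in the bisimulation below. For
    blanks, [size_w] places both intervals inside row 0 and beyond the input. *)
Lemma win_sound e a z e' m m' : (e, a, z, e') \in net_erules ->
  (m'%:Z - m%:Z)%R = weight_int z -> win e' m' -> win e m.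
Proof.
have Ld := L_double.
rewrite /net_erules /static_erules !mem_cat => /orP[|].
  case/orP=> [|].
    rewrite inE => /orP[/eqP[-> _ -> ->]|/mapP[c]].
      by move=> /= em [i mi Ci]; exists i => //; lia.
    rewrite mem_filter => /andP[ac _] [-> _ -> ->] /= em Cm.
    by exists m' => //; [lia|rewrite Cm].
  case/orP=> [|].
    rewrite !inE => /orP[]/eqP[-> _ -> ->] /= em.
      move/eqP; rewrite C_marker => m0; apply/eqP; rewrite C_marker.
      by have -> : m = m' + L; [lia|rewrite modnDr].
    move=> m0; apply/eqP; rewrite C_marker; have -> : m = 0 by lia.
    by rewrite mod0n.
  case/orP=> [|].
    rewrite !inE => /orP[]/eqP[-> _ -> ->] /= em h; apply: C_blank; lia.
  case/orP=> [|].
    rewrite !inE => /eqP[-> _ -> ->] /= em h; lia.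
  by case/orP=> [|]; rewrite !inE => /orP[]/eqP[-> _ -> ->] /= em h; lia.
case/orP=> [|].
  by case/flatten_mapP=> x _; rewrite !inE => /orP[]/eqP[-> _ -> ->] /= em h; lia.
case/orP=> [|].
  by case/flatten_mapP=> x _; rewrite !inE => /orP[]/eqP[-> _ -> ->] /=; rewrite expnS => em h; lia.
case/orP=> [|].
  by rewrite !inE => /eqP[-> _ -> ->] /= em h; rewrite -C_first; congr C; lia.
case/flatten_mapP=> x; rewrite mem_iota => xn; rewrite !inE => /eqP[-> _ -> ->] /= em h.
by rewrite (_ : m = x.+2); [apply: C_row0|]; lia.
Qed.

(** In row 0 the choice [None] is safe since 2^(R+1) cannot be subtracted. In the marker column it
    is safe since the claimed middle letter is no marker. Elsewhere [C_next] shows that one of the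
    three letters is wrong. *)
Lemma adam_choice (t : triple M) m : t.1.2 != None -> C m <> next_cell t ->
  exists j, forall m', (m'%:Z - m%:Z)%R = weight_int (wRow j R) -> C m' <> pick3 j t.
Proof.
case: t => [[x y] z] /= yN Cm.
have [mL|Lm] := ltnP m L; first by exists None => m' /=; lia.
have L0 : 0 < L by rewrite expn_gt0.
have [m0|m0] := boolP (m %% L == 0).
  exists None => m' /= em Cy; case/eqP: yN; rewrite -Cy; apply/eqP; rewrite C_marker.
  by move: m0; have -> : m = m' + L; [lia|rewrite modnDr].
move: Cm; rewrite C_next //.
have mL : L.+1 <= m.
  by rewrite ltn_neqAle Lm andbT; apply: contraNneq m0 => <-; rewrite modnn.
have [<-|xN] := eqVneq (C (m - L.+1)) x; last first.
  move=> _; exists (Some true) => m' /= em; apply/eqP.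
  by rewrite (_ : m' = m - L.+1) //; lia.
have [<-|yN'] := eqVneq (C (m - L)) y; last first.
  move=> _; exists None => m' /= em; apply/eqP.
  by rewrite (_ : m' = m - L) //; lia.
have [<-//|zN] := eqVneq (C (m - L.-1)) z.
move=> _; exists (Some false) => m' /= em; apply/eqP.
by rewrite (_ : m' = m - L.-1) //; lia.
Qed.

(** A gadget pair remembers that the choice [j] refutes the attacker. Dead configurations are
    related whatever their counters, because the zero test makes these differ. *)
Definition net_rel (c d : ctrl M nat * nat) : Prop :=
  [\/ c = d,
      exists e m, [/\ c = (inl (false, e), m), d = (inl (true, e), m) & ~ win e m],
      exists t j m, [/\ c = (inr (Some (t, None)), m), d = (inr (Some (t, Some j)), m) &
        forall m', (m'%:Z - m%:Z)%R = weight_int (wRow j R) -> C m' <> pick3 j t] |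
      c.1 = inr None /\ d.1 = inr None].

Lemma gadget_pickP (t : triple M) o a z q : (inr (Some (t, o)), a, z, q) \in net_rules ->
  exists i, [/\ t.1.2 != None, a = aTag _ i, z = wRow i R &
    q = inl (if o is Some j then i == j else false, claim _ (pick3 i t))].
Proof.
rewrite mem_net_rules => /orP[/flatten_mapP[[[[e a'] z'] e'] _ /mapP[b _ []]]//|].
rewrite mem_cat => /orP[/flatten_mapP[t']|]; last first.
  by rewrite !inE => /or4P[]/eqP[].
rewrite mem_filter => /andP[tP _].
rewrite mem_cat => /orP[|]; first by rewrite mem_seq1 => /eqP[].
rewrite mem_cat => /orP[|]; first by move=> /allpairsP[[b j] [_ _ []]].
rewrite mem_cat => /orP[|].
  by move=> /mapP[i _ [-> -> -> -> ->]]; exists i.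
by move=> /allpairsP[[j i] [_ _ [-> -> -> -> ->]]]; exists i.
Qed.

Lemma dead_rules a z q : (inr None, a, z, q) \notin net_rules.
Proof.
rewrite mem_net_rules negb_or; apply/andP; split; apply/negP.
  by case/flatten_mapP=> [[[[e a'] z'] e'] _ /mapP[b _ []]].
move/choice_rulesP=> [[t [j [_ _ _ [[b []]|[]]]]]|[[t [i [_ _ [[]|[j []]]]]]|[b [_ _ _ []]]]] //.
Qed.

Lemma evePredP b e a z q : (inl (b, e), a, z, q) \in net_rules ->
  [\/ exists2 e', (e, a, z, e') \in net_erules & q = inl (b, e'),
      exists t, [/\ t.1.2 != None, e = claim _ (next_cell t), a = aTriple _ t, z = wBool _ false &
        (exists j, q = inr (Some (t, Some j))) \/ (b = false /\ q = inr (Some (t, None)))] |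
      [/\ e = exactly 0 \/ e = below 0, a = aTag _ None,
          z = (if b then wPow 0 else wBool _ false) & q = inr None]].
Proof.
rewrite mem_net_rules => /orP[/mem_mirrors[e' -> rin]|]; first by apply: Or31; exists e'.
move/choice_rulesP=> [[t [j [tP -> -> h]]]|[[t [i [_ _ [[]|[j []]]]]]|[b' [-> -> -> h]]]] //.
  apply: Or32; exists t; case: h => [[b' [[-> ->] ->]]|[[-> ->] ->]]; split=> //.
    by left; exists j.
  by right.
by apply: Or33; case: h => [[-> ->]|[-> ->]]; split=> //; [left|right].
Qed.

Lemma mem_zero b e : e = exactly 0 \/ e = below 0 ->
  (inl (b, e), aTag _ None, (if b then wPow 0 else wBool _ false), inr None) \in net_rules.
Proof.
move=> h; rewrite mem_net_rules; apply/orP; right; rewrite mem_cat; apply/orP; right.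
by case: h => ->; case: b; rewrite !inE eqxx ?orbT.
Qed.

Lemma int_eq0 (m m' : nat) : (m'%:Z - m%:Z)%R = 0%R -> m' = m.
Proof. by lia. Qed.

Lemma net_rel_bisim : @bisimulation net_lts net_rel.
Proof.
split; move=> [q m] [p k] Rqp a [q' m'].
  case: Rqp => [[-> ->]|[e [x [[-> ->] [-> ->] nw]]]|[t [j [x [[-> ->] [-> ->] nC]]]]|[/= -> _]];
      move/net_transP=> [z rin em].
  - by exists (q', m'); split; [apply/net_transP; exists z|apply: Or41].
  - have [[e' ein ->]|[t [tP ee -> ez qt]]|[ez ea zz ->]] := evePredP rin.
    + exists (inl (true, e'), m'); split; first by apply/net_transP; exists z => //; apply: mem_eve.
      by apply: Or42; exists e', m'; split=> // /(win_sound ein em)/nw.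
    + have {em}-> : m' = x by apply: int_eq0; rewrite em ez.
      (* A decoy move is copied and gives identical configurations; entering the undecided state is
         answered by the choice of [adam_choice]. *)
      subst e; case: qt => [[j ->]|[_ ->]].
        exists (inr (Some (t, Some j)), x); split; last exact: Or41.
        by apply/net_transP; exists (wBool _ false); [apply: mem_decoy|rewrite GRing.subrr].
      have [j jP] := adam_choice tP nw.
      exists (inr (Some (t, Some j)), x); split.
        by apply/net_transP; exists (wBool _ false); [apply: mem_decoy|rewrite GRing.subrr].
      by apply: Or43; exists t, j, x.
    + exists (inr None, x.-1); rewrite ea; split; last exact: Or44.
      (* The false claim means a positive counter, so the second copy can subtract 1. *)
      have x0 : 0 < x by case: (x) nw ez => // nw [] e0; case: nw; rewrite e0 //= expn_gt0.
      by apply/net_transP; exists (wPow 0); [apply: (@mem_zero true)|rewrite /= expn0; lia].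
  - have [i [tP -> ez ->]] := gadget_pickP rin.
    exists (inl (i == j, claim _ (pick3 i t)), m'); split.
      by apply/net_transP; exists z => //; rewrite ez; apply: mem_decoy_pick.
    (* Tag [j] leads to a false claim by the choice of [j]; any other tag merges the two
       components. *)
    have [eij|_] := eqVneq i j; last exact: Or41.
    apply: Or42; exists (claim _ (pick3 i t)), m'; split=> //= Cm.
    by apply: (nC m'); rewrite -?eij // em ez.
  - by case/negP: (dead_rules a z q').
case: Rqp => [[-> ->]|[e [x [[-> ->] [-> ->] nw]]]|[t [j [x [[-> ->] [-> ->] nC]]]]|[_ /= ->]];
    move/net_transP=> [z rin em].
- by exists (q', m'); split; [apply/net_transP; exists z|apply: Or41].
- have [[e' ein ->]|[t [tP ee -> ez qt]]|[ez ea zz ->]] := evePredP rin.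
  + exists (inl (false, e'), m'); split; first by apply/net_transP; exists z => //; apply: mem_eve.
    by apply: Or42; exists e', m'; split=> // /(win_sound ein em)/nw.
  + have {em}-> : m' = x by apply: int_eq0; rewrite em ez.
    (* The second copy has decoy moves only, and the first copy shares them. *)
    subst e; case: qt => [[j ->]|[]] //.
    exists (inr (Some (t, Some j)), x); split; last exact: Or41.
    by apply/net_transP; exists (wBool _ false); [apply: mem_decoy|rewrite GRing.subrr].
  + exists (inr None, x); rewrite ea; split; last exact: Or44.
    by apply/net_transP; exists (wBool _ false); [apply: (@mem_zero false)|rewrite GRing.subrr].
- have [i [tP -> ez ->]] := gadget_pickP rin.
  exists (inl (false, claim _ (pick3 i t)), m'); split.
    by apply/net_transP; exists z => //; rewrite ez; apply: mem_pick.
  have [eij|_] := eqVneq i j; last exact: Or41.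
  apply: Or42; exists (claim _ (pick3 i t)), m'; split=> //= Cm.
  by apply: (nC m'); rewrite -?eij // em ez.
- by case/negP: (dead_rules a z q').
Qed.

Lemma adam_bisim e m : ~ win e m ->
  @bisim_equiv net_lts (inl (false, e), m) (inl (true, e), m).
Proof.
move=> nw; exists net_rel; split; first exact: net_rel_bisim.
by apply: Or42; exists e, m.
Qed.

(** * True claims: no simulation relates the two copies *)

Section Attacker.

Variable Sim : ctrl M nat * nat -> ctrl M nat * nat -> Prop.
Hypothesis Sim_sim : @simulation net_lts Sim.

Notation lost e m := (~ Sim (inl (false, e), m) (inl (true, e), m)).

(** The second copy has a forced answer: gadget entries use actions foreign to attacker rules, zero
    tests start where [emove] is undefined, and otherwise [emove] is a function. *)
Lemma lost_move e a z e' m m' : (e, a, z, e') \in net_erules ->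
  (m'%:Z - m%:Z)%R = weight_int z -> lost e' m' -> lost e m.
Proof.
move=> ein em l Sm.
have tr : @lts_trans net_lts a (inl (false, e), m) (inl (false, e'), m').
  by apply/net_transP; exists z => //; apply: mem_eve.
have [[q k] [/net_transP[z' rin ek] Sm']] := Sim_sim Sm tr.
have [mv na] := net_erulesP ein.
have [[e2 /net_erulesP[mv2 _] eq]|[t [_ _ ea _ _]]|[ez ea _ _]] := evePredP rin.
- apply: l; move: mv2 Sm' ek; rewrite eq mv => -[<- <-].
  by rewrite -em => Sm' ek; rewrite (_ : m' = k) in Sm' *; last by lia.
- by case: (na t).
- by move: mv; case: ez => ->; rewrite ea.
Qed.

(** At counter 0 the second copy cannot perform its zero test of weight -1. *)
Lemma lost_zero e : e = exactly 0 \/ e = below 0 -> lost e 0.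
Proof.
move=> ez Sm.
have tr : @lts_trans net_lts (aTag _ None) (inl (false, e), 0) (inr None, 0).
  by apply/net_transP; exists (wBool _ false) => //; apply: (@mem_zero false).
have [[q k] [/net_transP[z' rin ek] _]] := Sim_sim Sm tr.
have [[e2 /net_erulesP[mv2 _] eq]|[t [_ _ ea _ _]]|[_ _ zz _]] := evePredP rin.
- by move: mv2; case: ez => ->.
- by [].
- by move: ek; rewrite zz /= expn0; lia.
Qed.

Lemma mem_count v : v < n.+2 -> {subset count_rules 0 v.+1 v <= net_erules}.
Proof.
move=> vn r rin; rewrite mem_cat; apply/orP.
have [v_n|n_v] := ltnP v n.
  right; rewrite mem_cat; apply/orP; left.
  by apply/flatten_mapP; exists v; rewrite // mem_iota.
left; do 4!(rewrite mem_cat; apply/orP; right).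
rewrite mem_cat; apply/orP; have [ev|nv] := eqVneq v n.
  by left; rewrite -{1}ev -ev.
by right; have <- : v = n.+1 by lia.
Qed.

Lemma mem_bit v : v < R -> {subset bit_rules v.+1 v <= net_erules}.
Proof.
move=> vR r rin; do 2!(rewrite mem_cat; apply/orP; right).
rewrite mem_cat; apply/orP; left.
by apply/flatten_mapP; exists v; rewrite // mem_iota.
Qed.

Lemma lost_exactly v : v <= n.+2 -> lost (exactly v) v.
Proof.
elim: v => [_|v IH vn]; first by apply: lost_zero; left.
apply: (@lost_move _ (aTag _ None) (wPow 0) (exactly v) _ v).
- by apply: (mem_count vn); rewrite mem_head.
- by rewrite /= expn0; lia.
- by apply: IH; apply: ltnW.
Qed.

(** The attacker spells out the binary digits of [m] from the most significant one. *)
Lemma lost_below v m : v <= R -> m < 2 ^ v -> lost (below v) m.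
Proof.
elim: v m => [|v IH] m vR; first by case: m => // _; apply: lost_zero; right.
have [mv _|vm] := ltnP m (2 ^ v).
  apply: (@lost_move _ (aTag _ None) (wBool _ false) (below v) _ m).
  - by apply: (mem_bit vR); rewrite mem_head.
  - by rewrite GRing.subrr.
  - by apply: IH => //; apply: ltnW.
rewrite expnS => mv; apply: (@lost_move _ (aTag _ (Some true)) (wPow v) (below v) _ (m - 2 ^ v)).
- by apply: (mem_bit vR); rewrite in_cons mem_seq1 eqxx orbT.
- by rewrite /=; lia.
- by apply: IH; [apply: ltnW|lia].
Qed.

Lemma lost_window v m : v <= n.+2 -> v <= m < v + 2 ^ R -> lost (window v) m.
Proof.
elim: v m => [|v IH] m vn; rewrite ?add0n.
  move=> mR; apply: (@lost_move _ (aTag _ None) (wBool _ false) (below R) _ m).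
  - rewrite mem_cat; apply/orP; left; do 3!(rewrite mem_cat; apply/orP; right).
    by rewrite mem_cat; apply/orP; left; rewrite mem_head.
  - by rewrite GRing.subrr.
  - exact: lost_below.
move=> vm; apply: (@lost_move _ (aTag _ None) (wPow 0) (window v) _ m.-1).
- by apply: (mem_count vn); rewrite in_cons mem_seq1 eqxx orbT.
- by rewrite /= expn0; lia.
- by apply: IH; [apply: ltnW|lia].
Qed.

(** The second copy cannot enter [(t, None)], so it commits to some [j] and the attacker plays tag
    [j]. Since [j] is arbitrary, all three subtractions must be possible and lead to lost pairs. *)
Lemma lost_pick (t : triple M) m : t.1.2 != None ->
  (forall j m', (m'%:Z - m%:Z)%R = weight_int (wRow j R) -> lost (claim _ (pick3 j t)) m') ->
  (forall j, exists m', (m'%:Z - m%:Z)%R = weight_int (wRow j R)) ->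
  lost (claim _ (next_cell t)) m.
Proof.
move=> tP l ex Sm.
have tr : @lts_trans net_lts (aTriple _ t) (inl (false, claim _ (next_cell t)), m)
    (inr (Some (t, None)), m).
  by apply/net_transP; exists (wBool _ false); rewrite ?GRing.subrr //; apply: mem_enter.
have [[q k] [/net_transP[z rin ek] Sm']] := Sim_sim Sm tr.
have [[e2 /net_erulesP[_ na] _]|[t' [_ _ [et] ez qt]]|[_ //]] := evePredP rin.
  by case: (na t).
case: qt => [[j eq]|[]//]; subst t' q.
have {ek}ek : k = m by apply: int_eq0; rewrite ek ez.
subst k; have [m' em] := ex j.
have tr' : @lts_trans net_lts (aTag _ j) (inr (Some (t, None)), m)
    (inl (false, claim _ (pick3 j t)), m').
  by apply/net_transP; exists (wRow j R) => //; apply: mem_pick.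
have [[q k] [/net_transP[z' rin' ek] Sm'']] := Sim_sim Sm' tr'.
have [i [_ [ei] ez' eq]] := gadget_pickP rin'; subst i q.
apply: (l j m' em); move: ek Sm''; rewrite ez' eqxx -em => ek.
by rewrite (_ : k = m') //; lia.
Qed.

(** Strong induction on the index. After row 0 the attacker names the true letters above, which lie
    at smaller indices; a marker is traced back to index 0, and the other cells of row 0 are checked
    against the input or the blank intervals. *)
Lemma lost_claim i : lost (claim _ (C i)) i.
Proof.
have Ld := L_double; have L0 : 0 < L by rewrite expn_gt0.
have static : {subset static_erules 0 R n n.+1 n.+2 <= net_erules}.
  by move=> r rin; rewrite mem_cat rin.
elim/ltn_ind: i => i IH.
have [i0|i0] := boolP (i %% L == 0).
  have -> : C i = None by apply/eqP; rewrite C_marker.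
  have [iL|Li] := ltnP i L.
    have -> : i = 0 by move: i0; rewrite modn_small // => /eqP.
    apply: (@lost_move _ (aTag _ (Some true)) (wBool _ false) (exactly 0) _ 0) => //.
      apply: static; rewrite mem_cat; apply/orP; right; rewrite mem_cat; apply/orP; left.
      by rewrite in_cons mem_seq1 eqxx orbT.
    exact: lost_exactly.
  apply: (@lost_move _ (aTag _ None) (wRow None R) (claim _ None) _ (i - L)).
  - apply: static; rewrite mem_cat; apply/orP; right; rewrite mem_cat; apply/orP; left.
    by rewrite mem_head.
  - by rewrite /=; lia.
  have <- : C (i - L) = None.
    by apply/eqP; rewrite C_marker -(modnDr _ L) subnK.
  by apply: IH; rewrite ltn_subrL L0 (leq_trans L0).
have ipos : 0 < i by case: (i) i0 => //; rewrite mod0n.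
have [iL|Li] := ltnP i L; last first.
  (* The marker column is excluded, so even [L + 1] can be subtracted. *)
  have Li' : L < i by rewrite ltn_neqAle Li andbT; apply: contraNneq i0 => <-; rewrite modnn.
  rewrite C_next //; apply: lost_pick => /=.
  - by rewrite C_marker; move: i0; rewrite -[in X in X -> _](subnK Li) modnDr.
  - case=> [[]|] m' /= em.
    + by rewrite (_ : i - L.+1 = m'); [apply: IH|]; lia.
    + by rewrite (_ : i - L.-1 = m'); [apply: IH|]; lia.
    + by rewrite (_ : i - L = m'); [apply: IH|]; lia.
  - case=> [[]|] /=.
    + by exists (i - L.+1); lia.
    + by exists (i - L.-1); lia.
    + by exists (i - L); lia.
have [|ni] := ltnP i n.+2.
  case: i {i0 IH} ipos iL => // -[|i] _ iL ni.
    rewrite C_first; apply: (@lost_move _ (aIndex 0) (wBool _ false) (exactly 1) _ 1) => //.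
      do 3!(rewrite mem_cat; apply/orP; right); rewrite mem_cat; apply/orP; left.
      by rewrite mem_head.
    exact: lost_exactly.
  rewrite C_row0 //.
  apply: (@lost_move _ (aIndex i.+1) (wBool _ false) (exactly i.+2) _ i.+2).
  - do 4!(rewrite mem_cat; apply/orP; right).
    by apply/flatten_mapP; exists i; [rewrite mem_iota; lia|rewrite mem_head].
  - by rewrite GRing.subrr.
  - by apply: lost_exactly; apply: ltnW.
rewrite C_blank ?ni //.
have mb : {subset blank_rules n.+2 R <= net_erules}.
  move=> r rin; apply: static; do 2!(rewrite mem_cat; apply/orP; right).
  by rewrite mem_cat rin.
have [iR|Ri] := ltnP i (n.+2 + 2 ^ R).
  apply: (@lost_move _ (aTag _ None) (wBool _ false) (window n.+2) _ i).
  - by apply: mb; rewrite mem_head.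
  - by rewrite GRing.subrr.
  - by apply: lost_window; rewrite ?ni.
apply: (@lost_move _ (aTag _ (Some true)) (wPow R) (below R) _ (i - 2 ^ R)).
- by apply: mb; rewrite in_cons mem_seq1 eqxx orbT.
- by rewrite /=; lia.
- by apply: lost_below => //; lia.
Qed.

(** Induction on the distance to the index [i]: the attacker increments up to [i] and then claims
    its true content. *)
Lemma lost_guess : (exists i, accepting (C i)) -> lost (inl None) 0.
Proof.
move=> [i ai].
suff H d : d <= i -> lost (inl None) (i - d) by have := H i (leqnn i); rewrite subnn.
elim: d => [_|d IH di].
  rewrite subn0; apply: (@lost_move _ (aCell _ (C i)) (wBool _ false) (claim _ (C i)) _ i).
  - rewrite mem_cat; apply/orP; left; rewrite mem_cat; apply/orP; left.
    rewrite in_cons; apply/orP; right; apply/mapP; exists (C i) => //.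
    by rewrite mem_filter ai mem_enum.
  - by rewrite GRing.subrr.
  - exact: lost_claim.
apply: (@lost_move _ (aTag _ None) (wBool _ true) (inl None) _ (i - d)).
- by rewrite mem_cat; apply/orP; left; rewrite mem_cat; apply/orP; left; rewrite mem_head.
- by rewrite /=; lia.
- by apply: IH; apply: ltnW.
Qed.

End Attacker.

Lemma net_sim_guess : (exists i, accepting (C i)) ->
  ~ @sim_preorder net_lts (inl (false, inl None), 0) (inl (true, inl None), 0).
Proof. by move=> ex [Sim [Sim_sim S0]]; apply: (lost_guess Sim_sim ex). Qed.

Lemma net_bisim_guess : ~ (exists i, accepting (C i)) ->
  @bisim_equiv net_lts (inl (false, inl None), 0) (inl (true, inl None), 0).
Proof. by move=> nex; apply: adam_bisim => -[i _ ai]; apply: nex; exists i. Qed.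

End Net.

(** * The computation table *)

Section Table.

Variable M : tm 0.

Lemma tm_nextE (c : tm_conf M) :
  tm_next c = delta1 (conf_state c) (conf_tape c ord0 (conf_head c ord0)).
Proof. by congr tm_delta; apply/ffunP=> i; rewrite !ffunE ord1. Qed.

Definition cell_at (c : tm_conf M) (j : nat) :=
  Some (conf_tape c ord0 j, if conf_head c ord0 == j then Some (conf_state c) else None).

Definition left_cell (c : tm_conf M) (j : nat) := if j is j'.+1 then cell_at c j' else None.

Lemma arriving_right (c : tm_conf M) j :
  arriving MoveRight (left_cell c j) =
    if tm_next c is Some (q, a) then
      if (a ord0).2 is MoveRight then
        if (conf_head c ord0).+1 == j then Some q else None
      else None
    else None.
Proof.
rewrite tm_nextE; case: j => [|j] /=.
  by case: (delta1 _ _) => [[q a]|] //; case: (a ord0).2.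
rewrite eqSS; case: eqP => [->|ne] //.
by case: (delta1 _ _) => [[q a]|] //; case: (a ord0).2.
Qed.

Lemma arriving_left (c : tm_conf M) j :
  arriving MoveLeft (cell_at c j) =
    if tm_next c is Some (q, a) then
      if (a ord0).2 is MoveLeft then
        if conf_head c ord0 == j then Some q else None
      else None
    else None.
Proof.
rewrite tm_nextE /=; case: eqP => [->|ne] //.
by case: (delta1 _ _) => [[q a]|] //; case: (a ord0).2.
Qed.

(** The right neighbour matters only through a head arriving from it. The marker of the next row can
    therefore replace a neighbour that is not under the head. *)
Lemma next_cell_at (c : tm_conf M) j z :
  z = cell_at c j.+1 \/ z = None /\ conf_head c ord0 != j.+1 ->
  next_cell (left_cell c j, cell_at c j, z) = cell_at (tm_step c) j.
Proof.
move=> zP; have {zP} : arriving MoveLeft z = arriving MoveLeft (cell_at c j.+1).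
  case: zP => [->//|[-> nh]]; rewrite arriving_left (negbTE nh).
  by case: (tm_next c) => [[q a]|] //; case: (a ord0).2.
rewrite arriving_left /next_cell /cell_at arriving_right /tm_step => ->.
have [hj|hj] := eqVneq (conf_head c ord0) j.
  rewrite -hj -tm_nextE; case: (tm_next c) => [[q a]|] /=; last by rewrite !eqxx.
  rewrite eqxx; case: (a ord0) => s [] /=.
  - by case: (conf_head c ord0) => [|h] //=; rewrite ltn_eqF.
  - by rewrite eqxx.
  - by rewrite gtn_eqF.
case: (tm_next c) => [[q a]|] /=; last by rewrite (negbTE hj).
have jh : (j == conf_head c ord0) = false by rewrite eq_sym (negbTE hj).
case: (a ord0) => s [] /=; rewrite jh ?(negbTE hj) //.
  by case: (conf_head c ord0) hj => [|h] hj //=; rewrite (negbTE hj).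
by case: eqP.
Qed.

Variables (u : seq (tm_sym M)) (R : nat).

Notation L := (2 ^ R.+1).

(** Column 0 is the marker, so tape cell [j] sits in column [j + 1]. *)
Definition table (i : nat) :=
  if i %% L == 0 then None else cell_at (tm_run u (i %/ L)) (i %% L).-1.

Hypothesis head_lt : forall t, (conf_head (tm_run u t) ord0).+1 < L.

Lemma table_at t j : j < L ->
  table (t * L + j) = if j is j'.+1 then cell_at (tm_run u t) j' else None.
Proof.
move=> jL; rewrite /table modnMDl modn_small // divnMDl ?expn_gt0 //.
by rewrite divn_small // addn0; case: j jL.
Qed.

Lemma table_marker i : (table i == None) = (i %% L == 0).
Proof. by rewrite /table; case: ifP. Qed.

Lemma table_first : table 1 = first_cell (onth u 0).
Proof.
have L1 : 1 < L by rewrite -[1]/(2 ^ 0) ltn_exp2l.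
by rewrite -[1]/(0 * L + 1) table_at.
Qed.

Lemma table_row0 i : 0 < i -> i.+1 < L -> table i.+1 = tape_cell (onth u i).
Proof. by case: i => // i _ iL; rewrite -[i.+2]/(0 * L + i.+2) table_at. Qed.

Lemma table_next i : L <= i -> i %% L != 0 ->
  table i = next_cell (table (i - L.+1), table (i - L), table (i - L.-1)).
Proof.
move=> Li iL; have L0 : 0 < L by rewrite expn_gt0.
have L1 : 1 < L by rewrite -[1]/(2 ^ 0) ltn_exp2l.
have [t [j [ei jL]]] : exists t j, i = t.+1 * L + j.+1 /\ j.+1 < L.
  exists (i %/ L).-1, (i %% L).-1; rewrite !prednK ?lt0n // ?ltn_mod //.
    by rewrite -divn_eq.
  by rewrite -lt0n divn_gt0.
have -> : i - L.+1 = t * L + j by rewrite ei mulSn; lia.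
have -> : i - L = t * L + j.+1 by rewrite ei mulSn; lia.
rewrite ei !table_at //; last exact: ltnW.
rewrite -[tm_run u t.+1]/(tm_step (tm_run u t)); symmetry; apply: next_cell_at.
have [jL'|Lj] := ltnP j.+2 L.
  left; have -> : t.+1 * L + j.+1 - L.-1 = t * L + j.+2 by rewrite mulSn; lia.
  by rewrite table_at.
(* In the last column the third letter above is the marker of the next row, and [head_lt] keeps the
   head off the cell that it replaces. *)
have eL : L = j.+2 by lia.
right; have -> : t.+1 * L + j.+1 - L.-1 = t.+1 * L + 0 by lia.
rewrite table_at //; split=> //.
by have := head_lt t; rewrite [in X in X -> _]eL ltnS neq_ltn => ->.
Qed.

Lemma table_accepting (acc : pred (tm_state M)) :
  (exists i, accepting acc (table i)) <->
  (exists t, tm_halted (tm_run u t) /\ acc (conf_state (tm_run u t))).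
Proof.
split=> [[i]|[t [ht at_]]].
  rewrite /table; case: ifP => // _; set c := tm_run u _ => ai; exists (i %/ L).
  rewrite /tm_halted tm_nextE -/c; move: ai => /=; case: eqP => // ->.
  by case: (delta1 _ _).
exists (t * L + (conf_head (tm_run u t) ord0).+1); rewrite table_at //= eqxx.
by move: ht; rewrite /tm_halted tm_nextE => ->.
Qed.

Lemma halted_unique t1 t2 : tm_halted (tm_run u t1) -> tm_halted (tm_run u t2) ->
  tm_run u t1 = tm_run u t2.
Proof.
have stay t k : tm_halted (tm_run u t) -> tm_run u (k + t) = tm_run u t.
  move=> ht; elim: k => //= k IH.
  by rewrite -[LHS]/(tm_step (tm_run u (k + t))) IH /tm_step ht.
move=> h1 h2; have [le|/ltnW le] := leqP t1 t2; rewrite -(subnK le).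
  by rewrite stay.
by rewrite stay.
Qed.

End Table.

(** * Printing a net *)

(** Fixed items come first, then one block of [#|U|] numbers for each value of [v]. The number is
    affine in [v], hence printable in unary from a counter. *)
Definition index (T U : finType) (x : T + U * nat) : nat :=
  match x with
  | inl t => enum_rank t
  | inr (u, v) => #|T| + v * #|U| + enum_rank u
  end.

Lemma index_inj (T U : finType) : injective (@index T U).
Proof.
move=> [t|[u v]] [t'|[u' v']] /=.
- by move/val_inj/enum_rank_inj->.
- by move=> e; have := ltn_ord (enum_rank t); rewrite e -addnA ltnNge leq_addr.
- by move=> e; have := ltn_ord (enum_rank t'); rewrite -e -addnA ltnNge leq_addr.
have lt (x : U) : enum_rank x < #|U| by exact: ltn_ord.
rewrite -!addnA => /addnI e.
have ev : v = v'.
  have := congr1 (fun m => m %/ #|U|) e.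
  by rewrite !divnMDl ?divn_small ?addn0 //; apply: leq_ltn_trans (lt u).
by move: e; rewrite ev => /addnI/val_inj/enum_rank_inj->.
Qed.

Lemma index_le (T U : finType) (x : T + U * nat) B :
  (if x is inr (u, v) then v < B else true) -> index x <= #|T| + B * #|U|.
Proof.
case: x => [t _|[u v] vB] /=; first by apply: leq_trans (ltnW (ltn_ord _)) (leq_addr _ _).
rewrite -addnA leq_add2l; apply: leq_trans (leq_mul vB (leqnn _)).
by rewrite mulSn addnC leq_add2r ltnW.
Qed.

(* [(c, r)] stands for [c] plus the value of the counter denoted by [r]. *)
Notation svar := (nat * option (option bool))%type.

Definition counter_of (r : option bool) : 'I_7 :=
  match r with None => tN | Some true => tR | Some false => tX end.

Definition sv_val (h : seq nat) (v : svar) : nat :=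
  v.1 + (if v.2 is Some r then nth 0 h (counter_of r) else 0).

Notation bit_em := (em (option bool) 5).

Definition em_text1 (s : seq (option bool)) : bit_em := (None, s).

Definition em_rep (d : option bool) (c : nat) (v : svar) : seq bit_em :=
  em_text1 (nseq (v.1 * c) d) ::
  (if v.2 is Some r then [:: (Some (counter_of r), nseq c d)] else [::]).

Lemma flatten_nseq_nseq (T : Type) (d : T) k c : flatten (nseq k (nseq c d)) = nseq (k * c) d.
Proof. by elim: k => //= k ->; rewrite -nseqD. Qed.

Lemma emsval_cons h e (es : seq bit_em) : emsval h (e :: es) = emval h e ++ emsval h es.
Proof. by []. Qed.

Lemma emsval_cat h (s t : seq bit_em) : emsval h (s ++ t) = emsval h s ++ emsval h t.
Proof. by rewrite /emsval map_cat flatten_cat. Qed.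

Lemma emval_text h s : emval h (em_text1 s) = s.
Proof. by rewrite /emval /= cats0. Qed.

Lemma emsval_rep h d c v : emsval h (em_rep d c v) = nseq (sv_val h v * c) d.
Proof.
rewrite /em_rep emsval_cons emval_text /sv_val mulnDl nseqD; congr cat.
by case: v => v [r|] //=; rewrite emsval_cons cats0 /emval /= flatten_nseq_nseq.
Qed.

Lemma em_rep_wf d c v : all (em_wf tY) (em_rep d c v).
Proof. by case: v => v [[[]|]|]. Qed.

Definition em_index (T U : finType) (x : T + U * svar) : seq bit_em :=
  match x with
  | inl t => [:: em_text1 (nseq (enum_rank t) (Some true))]
  | inr (u, v) =>
      em_text1 (nseq (#|T| + enum_rank u) (Some true)) :: em_rep (Some true) #|U| v
  end.

Definition index_map (T U V W : Type) (f : V -> W) (x : T + U * V) : T + U * W :=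
  match x with inl t => inl t | inr (u, v) => inr (u, f v) end.

Lemma emsval_index (T U : finType) h (x : T + U * svar) :
  emsval h (em_index x) = nseq (index (index_map (sv_val h) x)) (Some true).
Proof.
case: x => [t|[u v]]; rewrite /em_index emsval_cons emval_text; first by rewrite cats0.
by rewrite emsval_rep -nseqD addnAC.
Qed.

Lemma em_index_wf (T U : finType) (x : T + U * svar) : all (em_wf tY) (em_index x).
Proof. by case: x => [t|[u v]] //; apply: em_rep_wf. Qed.

(** The exponent v+1 keeps the lowest bit free: 2^(v+1) + 1 reads 1, v zeros, 1, and 2^(v+1) - 1 is
    a block of v+1 ones. The weight 0 consists of its sign bit alone. *)
Definition em_weight (z : weight svar) : seq bit_em :=
  match z with
  | inl (inl false) => [:: em_text1 [:: Some false]]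
  | inl (inl true) => [:: em_text1 [:: Some false; Some true]]
  | inl (inr v) =>
      em_text1 [:: Some true] :: em_rep (Some false) 1 v ++ [:: em_text1 [:: Some true]]
  | inr (None, v) =>
      em_text1 [:: Some true; Some false] :: em_rep (Some false) 1 v ++
      [:: em_text1 [:: Some true]]
  | inr (Some true, v) =>
      em_text1 [:: Some true; Some true] :: em_rep (Some false) 1 v ++
      [:: em_text1 [:: Some true]]
  | inr (Some false, v) =>
      em_text1 [:: Some true; Some true] :: em_rep (Some true) 1 v
  end.

Definition weight_map (V W : Type) (f : V -> W) (z : weight V) : weight W :=
  match z with
  | inl (inl b) => inl (inl b)
  | inl (inr v) => inl (inr (f v))
  | inr (j, v) => inr (j, f v)
  end.

Lemma int_bits_neg s m : last true s -> 0 < m -> bits_val s = m ->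
  int_bits (- m%:Z)%R = true :: s.
Proof.
move=> ls + em; rewrite -em /int_bits => m0; congr (_ :: _).
  by rewrite Num.Theory.oppr_lt0 ltz_nat m0.
by rewrite abszN absz_nat nat_bits_val.
Qed.

Lemma emsval_weight h z :
  emsval h (em_weight z) = map Some (int_bits (weight_int (weight_map (sv_val h) z))).
Proof.
have exp0 v : 0 < 2 ^ v by rewrite expn_gt0.
case: z => [[[]|v]|[[[]|] v]] //; cbv beta iota delta [em_weight];
  rewrite (emsval_cons _ (em_text1 _)) emval_text ?emsval_cat emsval_rep muln1
    ?(emsval_cons _ (em_text1 _)) ?emval_text ?cats0.
- rewrite (@int_bits_neg (nseq (sv_val h v) false ++ [:: true])) //.
  + by rewrite /= map_cat map_nseq.
  + by rewrite last_cat.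
  + by rewrite bits_val_cat bits_val_nseq size_nseq /=; lia.
- rewrite (@int_bits_neg (true :: nseq (sv_val h v) false ++ [:: true])) //.
  + by rewrite /= map_cat map_nseq.
  + by rewrite /= last_cat.
  + by rewrite /= bits_val_cat bits_val_nseq size_nseq /= expnS; lia.
- rewrite (@int_bits_neg (true :: nseq (sv_val h v) true)) //.
  + by rewrite /= map_nseq.
  + by elim: (sv_val h v).
  + by rewrite expnS; have := exp0 (sv_val h v); lia.
  + by rewrite /= bits_val_nseq expnS; have := exp0 (sv_val h v); lia.
- rewrite (@int_bits_neg (false :: nseq (sv_val h v) false ++ [:: true])) //.
  + by rewrite /= map_cat map_nseq.
  + by rewrite /= last_cat.
  + by rewrite /= bits_val_cat bits_val_nseq size_nseq /= expnS; lia.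
Qed.

Lemma em_weight_wf z : all (em_wf tY) (em_weight z).
Proof. by case: z => [[[]|[v [[[]|]|]]]|[[[]|] [v [[[]|]|]]]]. Qed.

(** * Texts of rules, and bounds on the numbers they contain *)

Section Numbering.

Variables (M : tm 0) (acc : pred (tm_state M)).

Definition ctrl_split (V : Type) (q : ctrl M V) : static_ctrl M + chain * V :=
  match q with
  | inl (b, inl g) => inl (inl (b, g))
  | inl (b, inr (f, v)) => inr ((b, f), v)
  | inr o => inl (inr o)
  end.

Lemma ctrl_split_inj V : injective (@ctrl_split V).
Proof. by move=> [[b [g|[f v]]]|o] [[b' [g'|[f' v']]]|o'] /= *; congruence. Qed.

Definition ctrl_num (q : ctrl M nat) : nat := index (ctrl_split q).
Definition act_num (a : act M nat) : nat := index a.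

Lemma ctrl_num_inj : injective ctrl_num.
Proof. exact: inj_comp (@index_inj _ _) (@ctrl_split_inj _). Qed.

Lemma act_num_inj : injective act_num.
Proof. exact: index_inj. Qed.

Definition rule_text (r : rule M nat) : seq (option bool) :=
  let: (q, a, z, q') := r in
  field (unary (ctrl_num q)) ++ field (unary (act_num a)) ++
  field (int_bits (weight_int z)) ++ field (unary (ctrl_num q')).

Definition em_sep : bit_em := em_text1 [:: None].

Definition em_rule (r : rule M svar) : seq bit_em :=
  let: (q, a, z, q') := r in
  em_index (ctrl_split q) ++ em_sep :: em_index a ++ em_sep :: em_weight z ++
  em_sep :: em_index (ctrl_split q') ++ [:: em_sep].

(** * Rule schemes commute with a change of index type *)

Section Map.

Variables (V W : Type) (f : V -> W).

Definition position_map (e : position M V) : position M W :=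
  match e with inl g => inl g | inr (k, v) => inr (k, f v) end.

Definition ctrl_map (q : ctrl M V) : ctrl M W :=
  match q with inl (b, e) => inl (b, position_map e) | inr o => inr o end.

Definition rule_map (r : rule M V) : rule M W :=
  let: (q, a, z, q') := r in (ctrl_map q, index_map f a, weight_map f z, ctrl_map q').

Definition erule_map (r : erule M V) : erule M W :=
  let: (e, a, z, e') := r in
  (position_map e, index_map f a, weight_map f z, position_map e').

Lemma ctrl_splitM q : ctrl_split (ctrl_map q) = index_map f (ctrl_split q).
Proof. by case: q => [[b [g|[k v]]]|o]. Qed.

Lemma mirrorsM es : map rule_map (mirrors es) = mirrors (map erule_map es).
Proof.
rewrite /mirrors map_flatten -!map_comp; congr flatten.
by apply: eq_map => -[[[e a] z] e'].
Qed.

Lemma static_erulesM v0 vR vn vn1 vn2 :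
  map erule_map (static_erules acc v0 vR vn vn1 vn2) =
  static_erules acc (f v0) (f vR) (f vn) (f vn1) (f vn2).
Proof. by rewrite /static_erules !map_cat /guess_rules /= -map_comp. Qed.

Lemma choice_rulesM v0 vR : map rule_map (@choice_rules M V v0 vR) = choice_rules M (f v0) (f vR).
Proof.
by rewrite /choice_rules map_cat map_flatten -map_comp; congr (flatten _ ++ _).
Qed.

End Map.

Lemma field_unary k : field (unary k) = nseq k (Some true) ++ [:: None].
Proof. by rewrite /field /unary map_nseq cats1. Qed.

Lemma emsval_rule h r : emsval h (em_rule r) = rule_text (rule_map (sv_val h) r).
Proof.
case: r => [[[q a] z] q']; rewrite /em_rule !emsval_cat !(emsval_cons _ em_sep) !emval_text.
rewrite emsval_cat !(emsval_cons _ em_sep) !emval_text.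
rewrite emsval_cat !(emsval_cons _ em_sep) !emval_text emsval_cat !emsval_index emsval_weight.
rewrite -!ctrl_splitM emsval_cons emval_text.
rewrite -[RHS]/(field (unary (ctrl_num (ctrl_map (sv_val h) q))) ++
  field (unary (act_num (index_map (sv_val h) a))) ++
  field (int_bits (weight_int (weight_map (sv_val h) z))) ++
  field (unary (ctrl_num (ctrl_map (sv_val h) q')))).
rewrite !field_unary -!catA.
by rewrite /field -cats1 -!catA.
Qed.

Definition em_rules (rs : seq (rule M svar)) : seq bit_em := flatten (map em_rule rs).

Lemma emsval_rules h rs :
  emsval h (em_rules rs) = flatten (map rule_text (map (rule_map (sv_val h)) rs)).
Proof.
elim: rs => //= r rs IH.
by rewrite -[em_rules _]/(em_rule r ++ em_rules rs) emsval_cat IH emsval_rule.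
Qed.

Lemma em_rules_wf rs : all (em_wf tY) (em_rules rs).
Proof.
elim: rs => //= r rs IH; rewrite all_cat IH andbT.
case: r => [[[q a] z] q']; rewrite /em_rule !all_cat /= !all_cat /= !all_cat /= !all_cat.
by rewrite !em_index_wf em_weight_wf.
Qed.

(** Indices reach at most n+2 for counting and [R] for bits. Their sum, unlike their maximum, is
    affine in the two counters. *)
Definition ctrl_bound (n R : nat) := #|{: static_ctrl M}| + (n + R + 3) * #|{: chain}|.
Definition act_bound (n R : nat) := #|{: tag_act M}| + (n + R + 3) * #|{: unit}|.

Definition position_small B (e : position M nat) := if e is inr (_, v) then v < B else true.
Definition act_small B (a : act M nat) := if a is inr (_, v) then v < B else true.

Lemma ctrl_num_le n R b e : position_small (n + R + 3) e -> ctrl_num (inl (b, e)) <= ctrl_bound n R.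
Proof. by move=> h; apply: index_le; case: e h => [g|[k v]]. Qed.

Lemma ctrl_num_le_gadget n R o : ctrl_num (inr o) <= ctrl_bound n R.
Proof. exact: index_le. Qed.

Lemma act_num_le n R a : act_small (n + R + 3) a -> act_num a <= act_bound n R.
Proof. by move=> h; apply: index_le; case: a h => [g|[k v]]. Qed.

Lemma net_erules_small u R e a z e' : (e, a, z, e') \in net_erules acc u R ->
  [&& position_small (size u + R + 3) e, act_small (size u + R + 3) a &
      position_small (size u + R + 3) e'].
Proof.
rewrite /net_erules /static_erules !mem_cat => /orP[|].
  case/orP=> [|].
    by rewrite inE => /orP[/eqP[-> -> _ ->]//|/mapP[c _ [-> -> _ ->]]].
  case/orP=> [|]; first by rewrite !inE => /orP[]/eqP[-> -> _ ->] //=; lia.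
  case/orP=> [|]; first by rewrite !inE => /orP[]/eqP[-> -> _ ->] /=; lia.
  case/orP=> [|]; first by rewrite !inE => /eqP[-> -> _ ->] /=; lia.
  by case/orP=> [|]; rewrite !inE => /orP[]/eqP[-> -> _ ->] /=; lia.
case/orP=> [|].
  by case/flatten_mapP=> x; rewrite mem_iota !inE => xn /orP[]/eqP[-> -> _ ->] /=; lia.
case/orP=> [|].
  by case/flatten_mapP=> x; rewrite mem_iota !inE => xn /orP[]/eqP[-> -> _ ->] /=; lia.
case/orP=> [|]; first by rewrite !inE => /eqP[-> -> _ ->] /=; lia.
by case/flatten_mapP=> x; rewrite mem_iota !inE => xn /eqP[-> -> _ ->] /=; lia.
Qed.

Lemma net_rules_bounded u R :
  all (bounded_rule ctrl_num act_num (ctrl_bound (size u) R) (act_bound (size u) R))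
    (map (@int_rule M) (net_rules acc u R)).
Proof.
rewrite all_map; apply/allP => -[[[q a] z] q']; rewrite mem_net_rules /= => /orP[|].
  case/flatten_mapP=> -[[[e a'] z'] e'] /net_erules_small/and3P[eb ab eb'].
  case/mapP=> b _ [-> -> _ ->]; apply/and3P; split;
    first [by apply: ctrl_num_le|by apply: ctrl_num_le_gadget|by apply: act_num_le].
move/choice_rulesP=> [[t [j [_ -> _ h]]]|[[t [i [-> _ h]]]|[b [-> _ -> h]]]].
- case: h => [[b [-> ->]]|[-> ->]]; apply/and3P; split;
    first [by apply: ctrl_num_le|by apply: ctrl_num_le_gadget|by apply: act_num_le].
- case: h => [[-> ->]|[j [-> ->]]]; apply/and3P; split;
    first [by apply: ctrl_num_le|by apply: ctrl_num_le_gadget|by apply: act_num_le].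
have b0 : 0 < size u + R + 3 by rewrite addn3.
case: h => ->; apply/and3P; split;
  first [by apply: ctrl_num_le|by apply: ctrl_num_le_gadget|by apply: act_num_le].
Qed.

Definition guess_ctrl (b : bool) : ctrl M nat := inl (b, inl None).

Definition net_instance (u : seq (tm_sym M)) (R : nat) : instance :=
  rule_instance ctrl_num act_num (ctrl_bound (size u) R) (act_bound (size u) R)
    (map (@int_rule M) (net_rules acc u R)) (guess_ctrl false, 0) (guess_ctrl true, 0).

End Numbering.

(** * The reduction *)

Lemma emsval_text h s : emsval h [:: em_text1 s] = s.
Proof. by rewrite emsval_cons emval_text cats0. Qed.

Section Reduction.

Variables (S : finType) (M : tm 0) (inp : S -> tm_sym M) (acc : pred (tm_state M)).
Variable p : {poly nat}.

Definition const_sv (c : nat) : svar := (c, None).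
Definition size_sv (c : nat) : svar := (c, Some None).
Definition exponent_sv (c : nat) : svar := (c, Some (Some true)).
Definition loop_sv (c : nat) : svar := (c, Some (Some false)).

(** The successor accounts for [rule_instance] using ordinals up to and including the bound. *)
Definition em_unary (T U : finType) : seq bit_em :=
  em_text1 (nseq (#|T| + 3 * #|U|).+1 (Some true)) ::
  em_rep (Some true) #|U| (size_sv 0) ++ em_rep (Some true) #|U| (exponent_sv 0) ++ [:: em_sep].

(** The first [None] ends the control state; the second is the whole field of the counter value 0,
    whose binary word is empty. *)
Definition guess_text (b : bool) : seq (option bool) :=
  nseq (ctrl_num (guess_ctrl M b)) (Some true) ++ [:: None; None].

Definition em_header : seq bit_em :=
  em_unary (static_ctrl M) chain ++ em_unary (tag_act M) unit ++
  [:: em_text1 (guess_text false ++ guess_text true)].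

Definition em_static : seq bit_em :=
  em_header ++
  em_rules (mirrors (static_erules acc (const_sv 0) (exponent_sv 0) (size_sv 0) (size_sv 1)
                       (size_sv 2)) ++
            choice_rules M (const_sv 0) (exponent_sv 0)).
Definition em_count : seq bit_em :=
  em_rules (mirrors (count_rules M (const_sv 0) (loop_sv 1) (loop_sv 0))).
Definition em_bits : seq bit_em := em_rules (mirrors (bit_rules M (loop_sv 1) (loop_sv 0))).
Definition em_first (o : option S) : seq bit_em :=
  em_rules (mirrors (input_rules (first_cell (omap inp o)) (const_sv 0) (const_sv 1))).
Definition em_input (o : option S) : seq bit_em :=
  em_rules (mirrors (input_rules (tape_cell (omap inp o)) (loop_sv 1) (loop_sv 2))).

Definition reduction : seq S -> seq (option bool) :=
  em_text em_static em_count em_bits em_first em_input p.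

Lemma polytime_reduction : polytime reduction.
Proof.
apply: polytime_em_text => *; exact: em_rules_wf.
Qed.

Lemma emsval_unary (T U : finType) i n r t x y :
  emsval [:: i; n; r; t; x; y] (em_unary T U) = field (unary (#|T| + (n + r + 3) * #|U|).+1).
Proof.
rewrite field_unary /em_unary (emsval_cons _ (em_text1 _)) emval_text !emsval_cat !emsval_rep.
rewrite (emsval_cons _ em_sep) emval_text cats0 !catA -!nseqD /sv_val /=.
by congr (_ :: nseq _ _ ++ _); rewrite !mulnDl; lia.
Qed.

Lemma encode_guess n r b :
  encode_conf (num (@ctrl_num M) (ctrl_bound M n r) (guess_ctrl M b, 0)) = guess_text b.
Proof.
rewrite /encode_conf /num /= inordK; last by rewrite ltnS; apply: ctrl_num_le.
by rewrite field_unary -catA.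
Qed.

Lemma encode_int_rule n r (x : rule M nat) :
  bounded_rule (@ctrl_num M) (@act_num M) (ctrl_bound M n r) (act_bound M n r) (int_rule x) ->
  encode_rule
    (num_rule (@ctrl_num M) (@act_num M) (ctrl_bound M n r) (act_bound M n r) (int_rule x)) =
  rule_text x.
Proof.
case: x => [[[q a] z] q'] /and3P[/= bq ba bq'].
by rewrite /encode_rule /= !inordK.
Qed.

(** Both sides are concatenations of the same blocks. On each block, evaluating the printed counter
    expressions amounts to instantiating the rule scheme with numbers. *)
Lemma reductionE w : reduction w = encode (net_instance acc (map inp w) p.[size w]%R).
Proof.
set n := size w; set r := p.[n]%R.
have nE : size (map inp w) = n by rewrite size_map.
have enc : flatten (map (@encode_rule _ _) (inst_rules (net_instance acc (map inp w) r))) =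
    flatten (map (@rule_text M) (net_rules acc (map inp w) r)).
  have mc T1 T2 T3 T4 (f : T3 -> T4) (g : T2 -> T3) (h : T1 -> T2) s :
    map f (map g (map h s)) = map (fun x => f (g (h x))) s by rewrite -!map_comp.
  congr flatten; apply: (etrans (mc _ _ _ _ _ _ _ _)); apply/eq_in_map => x xin.
  apply: encode_int_rule.
  by have /allP := net_rules_bounded acc (map inp w) r; apply; apply: map_f.
have -> : encode (net_instance acc (map inp w) r) =
    field (unary (ctrl_bound M (size (map inp w)) r).+1) ++
    field (unary (act_bound M (size (map inp w)) r).+1) ++
    encode_conf (num (@ctrl_num M) (ctrl_bound M (size (map inp w)) r) (guess_ctrl M false, 0)) ++
    encode_conf (num (@ctrl_num M) (ctrl_bound M (size (map inp w)) r) (guess_ctrl M true, 0)) ++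
    flatten (map (@encode_rule _ _) (inst_rules (net_instance acc (map inp w) r))) by [].
rewrite enc !encode_guess {enc}.
(* The program branches on letters of [S], whereas the net mentions tape symbols of [M]. *)
have first x : omap inp (onth w x) = onth (map inp w) x by rewrite onth_map.
pose T (rs : seq (rule M nat)) := flatten (map (@rule_text M) rs).
rewrite -[flatten (map _ _)]/(T (net_rules acc (map inp w) r)) /net_rules nE.
have Tcat rs rs' : T (rs ++ rs') = T rs ++ T rs' by rewrite /T map_cat flatten_cat.
have Tflat (V : Type) (f : V -> seq (rule M nat)) l :
    T (flatten [seq f x | x <- l]) = flatten [seq T (f x) | x <- l].
  by elim: l => //= x l IH; rewrite Tcat IH.
rewrite (Tcat (_ ++ _)) (Tcat (flatten _)) (Tcat (flatten _)).
rewrite (Tcat (mirrors (input_rules _ _ _))) !(Tflat nat).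
rewrite -[LHS]/(em_text _ _ _ _ _ _ _) /em_text -/n -[horner_rec p n]/r.
have em_rulesT h rs : emsval h (em_rules rs) = T (map (rule_map (sv_val h)) rs).
  exact: emsval_rules.
rewrite (emsval_cat _ em_header) (emsval_cat _ (em_unary _ _)) (emsval_cat _ (em_unary _ _)).
rewrite (emsval_unary (static_ctrl M)) (emsval_unary (tag_act M)) emsval_text.
have regroup (t1 t2 t3 t4 t5 t5' t6 t6' : seq (option bool)) : t5 = t5' -> t6 = t6' ->
    ((t1 ++ t2 ++ (t3 ++ t4)) ++ t5) ++ t6 = t1 ++ t2 ++ t3 ++ t4 ++ t5' ++ t6'.
  by move=> -> ->; rewrite -!catA.
apply: regroup; [rewrite em_rulesT; congr T|congr (flatten _ ++ (flatten _ ++ (_ ++ flatten _)))].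
- rewrite map_cat mirrorsM static_erulesM choice_rulesM.
  by [].
- by apply: eq_map => x; rewrite em_rulesT mirrorsM.
- by apply: eq_map => x; rewrite em_rulesT mirrorsM.
- by rewrite em_rulesT mirrorsM first.
- by apply: eq_map => x; rewrite em_rulesT mirrorsM first.
Qed.

End Reduction.

Theorem theorem3
  (rho : forall N : socn, lts_state (socn_lts N) -> lts_state (socn_lts N) -> Prop)
  (bisim_sub_rho : forall (N : socn) (c d : lts_state (socn_lts N)),
    bisim_equiv c d -> rho N c d)
  (rho_sub_sim : forall (N : socn) (c d : lts_state (socn_lts N)),
    rho N c d -> sim_preorder c d) :
  EXPSPACE_hard (relation_problem rho).
Proof.
move=> S A [M [inp [acc [p [inp_inj dec space]]]]].
(* The summand [p] bounds the head, and [X + 2] ensures that the input fits into half a row. *)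
pose p' : {poly nat} := (p + ('X + 2%:P))%R.
(* The attacker looks for a rejecting halt, so acceptance corresponds to bisimilarity. *)
exists (reduction inp (predC acc) p'); split; first exact: polytime_reduction.
move=> w; rewrite reductionE; set u := map inp w; set R := (p'.[size w])%R.
have RE : R = p.[size w]%R + (size w + 2) by rewrite /R /p' hornerD hornerD hornerX hornerC.
have size_u : (size u).+2 <= 2 ^ R.
  rewrite size_map; apply: leq_trans (_ : (size w).+2 <= 2 ^ (size w).+2) _.
    by apply: ltnW; apply: ltn_expl.
  by rewrite leq_exp2l // RE addn2 leq_addl.
have head_u t : (conf_head (tm_run u t) ord0).+1 < 2 ^ R.+1.
  apply: leq_ltn_trans (space w t) _.
  by rewrite ltn_exp2l // RE ltnS leq_addr.
pose C := table u R.
have [[[sizeC firstC] row0C] nextC] :=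
  (table_marker u R, table_first u R, @table_row0 _ u R, table_next head_u).
have bound b : ctrl_num (guess_ctrl M b) <= ctrl_bound M (size u) R by apply: ctrl_num_le.
have [t [ht accA]] := dec w.
(* All halted configurations of the run coincide, so a rejecting cell exists exactly when the halt
   found at [t] rejects. *)
have exC : (exists i, accepting (predC acc) (C i)) <-> ~~ acc (conf_state (tm_run u t)).
  rewrite (table_accepting head_u); split=> [[t' [ht' at']]|na]; last by exists t.
  by rewrite (halted_unique ht ht').
(* Injectivity of the encoding identifies the instance behind the word with the constructed net. *)
split=> [Aw|[I [/encode_inj <- rhoI]]].
  exists (net_instance (predC acc) u R); split=> //; apply: bisim_sub_rho.
  apply: (bisim_num (@ctrl_num_inj M) (net_rules_bounded (predC acc) u R)) => //; try exact: bound.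
  apply: (net_bisim_guess size_u sizeC firstC row0C nextC) => /exC.
  by move/accA: Aw => ->.
apply/accA/negPn/negP => /exC ex.
apply: (net_sim_guess size_u sizeC firstC row0C nextC ex).
apply: (sim_num (@ctrl_num_inj M) (@act_num_inj M) (net_rules_bounded (predC acc) u R)) => //;
  try exact: bound.
exact: rho_sub_sim rhoI.
Qed.
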